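(* Suppose $P(V_1>x)\sim L(x)x^{-\alpha}$ as $x\to\infty$, where $\alpha>2$ and $L$ is slowly varying, and let $\kappa=(\alpha-2)E[V_1^2]/(2E[V_1])$. Suppose that $y=y(\rho)$ satisfies $$y(\rho)=c\,\kappa\,(1-\rho)^{-1}\log\bigl((1-\rho)^{-1}\bigr)$$ for $\rho<1$, where $c>0$ is a constant. (a) If $0<c<1$, then $$\sup_{0\le x\le y(\rho)}\left|\frac{P(W_\infty(\rho)>x)}{\exp\bigl(-2(1-\rho)E[V_1]\,x/E[V_1^2]\bigr)}-1\right|\to 0\quad\text{as }\rho\nearrow 1.$$ This relation continues to hold when $c=1$, provided that $L(x)/(\log x)^{\alpha-1}\to 0$ as $x\to\infty$. (b) If $c>1$, then $$\sup_{x\ge y(\rho)}\left|\frac{P(W_\infty(\rho)>x)}{\frac{\rho}{1-\rho}P(X_1>x)}-1\right|\to 0\quad\text{as }\rho\nearrow 1.$$ This relation continues to hold when $c=1$, provided that $L(x)/(\log x)^{\alpha-1}\to\infty$ as $x\to\infty$.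
   Context: Setting: for $\rho\in(0,1)$, $W_\infty(\rho)$ is the steady-state waiting time (exclusive of service) in the M/G/1 first-in first-out queue with i.i.d. nonnegative processing times $V_n$ (whose distribution does not depend on $\rho$) and an independent Poisson arrival process of rate $\lambda=\rho/E[V_1]$. Let $X_1,X_2,\dots$ be i.i.d. with density $g(t)=P(V_1>t)/E[V_1]$ on $(0,\infty)$, and $S_0=0$, $S_n=X_1+\cdots+X_n$. The distribution of $W_\infty(\rho)$ is given by the Pollaczek--Khintchine formula $$P(W_\infty(\rho)>x)=\sum_{n=0}^\infty(1-\rho)\rho^n P(S_n>x),\qquad x\ge 0.$$ Here $f(x)\sim h(x)$ means $f(x)/h(x)\to1$. *)

(* Defs.v *)
From HB Require Import structures.
From mathcomp Require Export all_boot all_order all_algebra.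
From mathcomp Require Export all_classical all_reals all_analysis.
Export Order.TTheory GRing.Theory Num.Theory.
Export numFieldNormedType.Exports.

Set Implicit Arguments.
Unset Strict Implicit.
Unset Printing Implicit Defensive.

Local Open Scope classical_set_scope.
Local Open Scope ring_scope.

Section asymptotics.
Context {R : realType}.

Definition asymp_equiv (f h : R -> R) : Prop := f x / h x @[x --> +oo] --> (1 : R).

(* Only the behaviour of [L] on a half-line matters. *)
Definition slowly_varying (L : R -> R) : Prop :=
  exists A : R,
    [/\ measurable_fun `[A, +oo[ L,
        forall x, A <= x -> 0 < L x &
        forall t, 0 < t -> L (t * x) / L x @[x --> +oo] --> (1 : R)].

End asymptotics.

Section probability.
Context {d : measure_display} {T : measurableType d} {R : realType}.
Variable P : probability T R.

Definition tail (Y : {RV P >-> R}) (x : R) : R := fine (ccdf Y x).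

Definition mean (Y : {RV P >-> R}) : R := fine 'E_P[Y].

Definition second_moment (Y : {RV P >-> R}) : R := fine 'E_P[fun w => Y w ^+ 2].

Definition same_law (Y Z : {RV P >-> R}) : Prop :=
  forall A : set R, measurable A -> distribution P Y A = distribution P Z A.

Definition mutually_independent (I : eqType) (Y : I -> {RV P >-> R}) : Prop :=
  forall (s : seq I) (B : I -> set R), uniq s ->
    (forall i, measurable (B i)) ->
    P [set w | forall i, i \in s -> B i (Y i w)] =
      (\prod_(i <- s) P [set w | B i (Y i w)])%E.

Definition iid (Y : nat -> {RV P >-> R}) : Prop :=
  mutually_independent Y /\ forall n, same_law (Y n) (Y 0%N).

(* [Y] has density [g] on the half-line ]0, +oo[. *)
Definition has_density_pos (Y : {RV P >-> R}) (g : R -> R) : Prop :=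
  forall A : set R, measurable A ->
    distribution P Y A =
      (\int[lebesgue_measure]_(x in A `&` `]0%R, +oo[) (g x)%:E)%E.

Definition exponentially_distributed (rate : R) (Y : {RV P >-> R}) : Prop :=
  forall A : set R, measurable A ->
    distribution P Y A = exponential_prob rate A.

(* The Poisson arrival process of rate [lam] is given by its interarrival
   times [U n] (between the [n]-th and the [n+1]-st customer), which are i.i.d.
   exponential; independence of the arrivals and the service times is mutual
   independence of the combined family. *)
Definition MG1_input (lam : R) (V U : nat -> {RV P >-> R}) : Prop :=
  [/\ forall n w, 0 <= V n w,
      forall n, same_law (V n) (V 0%N),
      forall n, exponentially_distributed lam (U n) &
      mutually_independent
        (fun i : (nat + nat)%type =>
           match i with inl n => V n | inr n => U n end)].

(* Lindley's recursion: waiting time (exclusive of service) of the [n]-th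
   customer of a FIFO single-server queue, the customer 0 finding it empty. *)
Fixpoint waiting_time (V U : nat -> {RV P >-> R}) (n : nat) (w : T) : R :=
  if n is m.+1 then Num.max (waiting_time V U m w + V m w - U m w) 0 else 0.

(* Convergence in distribution of the waiting times to [W]. *)
Definition steady_state_waiting_time (V U : nat -> {RV P >-> R})
    (W : {RV P >-> R}) : Prop :=
  forall x : R, {for x, continuous (cdf W)} ->
    P [set w | waiting_time V U n w <= x] @[n --> \oo] --> cdf W x.

Definition partial_sum (X : nat -> {RV P >-> R}) (n : nat) (w : T) : R :=
  \sum_(i < n) X i w.

Definition pollaczek_khintchine (rho : R) (X : nat -> {RV P >-> R})
    (W : {RV P >-> R}) : Prop :=
  forall x : R, 0 <= x ->
    ccdf W x = (\sum_(0 <= n <oo)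
      ((1 - rho) * rho ^+ n)%:E * P [set w | (x < partial_sum X n w)%R])%E.

(* The suprema below are taken in the extended reals: the real-valued [sup]
   would be 0 on an unbounded set. *)
Definition heavy_traffic_approx (V0 : {RV P >-> R}) (W : R -> {RV P >-> R})
    (y : R -> R) : Prop :=
  ereal_sup [set (`|tail (W rho) x /
                     expR (- (2 * (1 - rho) * mean V0 * x / second_moment V0))
                    - 1|)%:E
            | x in [set x | 0 <= x <= y rho]] @[rho --> 1^'-] --> 0%E.

Definition heavy_tail_approx (X0 : {RV P >-> R}) (W : R -> {RV P >-> R})
    (y : R -> R) : Prop :=
  ereal_sup [set (`|tail (W rho) x / (rho / (1 - rho) * tail X0 x) - 1|)%:E
            | x in [set x | y rho <= x]] @[rho --> 1^'-] --> 0%E.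

End probability.

(* Main.v *)
From HB Require Import structures.
From mathcomp Require Import ring lra measurable_realfun.
Require Import Defs.

Set Implicit Arguments.
Unset Strict Implicit.
Unset Printing Implicit Defensive.

Local Open Scope classical_set_scope.
Local Open Scope ring_scope.

(** Write eps = 1 - rho, H for the tail of X 0, mu for its mean (which is
    E[V^2] / (2 E[V])), and S_n for the partial sums of X.  By the
    Pollaczek-Khintchine formula, W rho is distributed as S_N with N geometric
    of parameter rho, hence P(W rho > x) = E[rho^tau] where tau is the first n
    with S_n > x.  So h(s) = P(W rho > x - s) is the fixed point of the one-step
    relation
      h(s) = eps 1{s > x} + rho E[h(s + X 0)],
    and every supersolution (subsolution) u of this relation gives
    P(W rho > x) <= u 0 (u 0 <= P(W rho > x)):
    [tail_le_supersolution], [tail_ge_subsolution].  All probabilistic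
    estimates are instances of this comparison principle.

    Lower bounds.  The potential exp (theta (s - x - b)), with the jumps capped
    at b and theta slightly above eps / mu, gives exp (- theta (x + b)); a
    potential that is constant below x gives the one-big-jump bound
    rho H x / (eps + rho H x).

    Upper bounds.  The potential min (1, exp (theta (s - x))) plus an affine
    function of s, where theta is slightly below eps / mu, gives
      exp (- theta x) + (1 / eps) H b
    when jumps above b are simply discarded, and for b = eta x
      exp (- theta x) + (rho / eps) (H ((1 - delta) x) + o(H x))
    when a jump in ]b, (1 - delta) x] is charged only with the probability that
    the rest of the sum bridges the gap ([tail_le_potential]).  The truncated
    moment generating function admits theta = eps / mu (1 - eps^sigma) as long
    as b is a small multiple of (1 / eps) log (1 / eps), which makes
    exp (- theta x) equivalent to exp (- eps x / mu) in the relevant range.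
    For much larger x, theta proportional to log x / x suffices.

    It remains to compare exp (- eps x / mu) with H x / eps at
    x = c kappa (1 / eps) log (1 / eps): the former is eps^(c (alpha - 2)), the
    latter is eps^(alpha - 2) up to slowly varying and logarithmic factors, so
    that the exponential wins for c < 1, the tail wins for c > 1, and L decides
    when c = 1.  Only crude information on H is used, namely that H x is
    comparable with L x * x^(1 - alpha), that it is doubling, and that
    H ((1 - delta) x) / H x is close to 1 for small delta; all of it follows
    from the monotonicity of the tail G of V 0, from G (2 x) / G x converging to
    2^(-alpha), and from the fact that G / E[V] is the density of X 0. *)

(** * Partial sums of independent random variables *)
Section independence.
Context {d : measure_display} {T : measurableType d} {R : realType}.
Variable P : probability T R.
Local Open Scope ereal_scope.

(** The event E stands for everything that happens after the two variables; it
    is carried along so that independence of a partial sum from all later terms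
    can be proved by induction. *)
Lemma joint_law_eq_product (S X : T -> R) (E : set T) :
  measurable_fun setT S -> measurable_fun setT X -> measurable E ->
  (forall A B : set R, measurable A -> measurable B ->
     P (S @^-1` A `&` X @^-1` B `&` E) = P (S @^-1` A) * P (X @^-1` B) * P E) ->
  forall Z : set (R * R), measurable Z ->
    P ((fun w => (S w, X w)) @^-1` Z `&` E) =
    (pushforward P S \x pushforward P X) Z * P E.
Proof.
move=> mS mX mE SXE Z mZ.
pose S' : {mfun T >-> R} := HB.pack S (isMeasurableFun.Build _ _ _ _ _ mS).
pose X' : {mfun T >-> R} := HB.pack X (isMeasurableFun.Build _ _ _ _ _ mX).
have e0 : (0 <= fine (P E))%R by exact: fine_ge0.
pose nS := distribution P S'.
pose nX := mscale (NngNum e0) (distribution P X').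
have mSX : measurable_fun setT (fun w => (S w, X w)) by exact: measurable_fun_pair.
pose SX : {mfun T >-> (R * R)%type} := HB.pack (fun w => (S w, X w)) (isMeasurableFun.Build _ _ _ _ _ mSX).
pose m' := pushforward (mrestr P mE) SX.
have := @product_measure_unique _ _ _ _ R nS nX m'.
move=> /(_ mSX _ Z mZ) H.
transitivity ((nS \x nX) Z); last first.
  rewrite /product_measure1/= /mscale /=.
  under eq_integral do rewrite /= /mscale /=.
  rewrite ge0_integralZl//=; last first.
    exact: (measurable_fun_xsection (distribution P X')).
  by rewrite fineK ?fin_num_measure// muleC.
apply/esym/H => A B mA mB.
rewrite /nX /= /mscale/= /m' /pushforward /mrestr/= fineK ?fin_num_measure//.
rewrite muleCA (muleC (P E)) -SXE//.
Qed.

Lemma partial_sum_measurable (X : nat -> {RV P >-> R}) n :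
  measurable_fun setT (partial_sum X n).
Proof. by apply: measurable_sum => i; exact: measurable_funP. Qed.

Lemma partial_sumS (X : nat -> {RV P >-> R}) n w :
  partial_sum X n.+1 w = (partial_sum X n w + X n w)%R.
Proof. by rewrite /partial_sum big_ord_recr. Qed.

(** Adding one term at a time: by induction, S_n, X_n and the later terms satisfy
    the product rule on rectangles, so [joint_law_eq_product] applied to the
    set of pairs whose sum lies in A gives the same for S_(n+1). *)
Lemma partial_sum_indep (X : nat -> {RV P >-> R}) :
  mutually_independent X ->
  forall n (A : set R) (s : seq nat) (B : nat -> set R),
    measurable A -> uniq s -> (forall i, i \in s -> (n <= i)%N) ->
    (forall i, measurable (B i)) ->
    P (partial_sum X n @^-1` A `&` [set w | forall i, i \in s -> B i (X i w)]) =
    P (partial_sum X n @^-1` A) * P [set w | forall i, i \in s -> B i (X i w)].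
Proof.
move=> indX.
have mE (s : seq nat) (B : nat -> set R) : (forall i, measurable (B i)) ->
    measurable [set w | forall i, i \in s -> B i (X i w)].
  move=> mB; elim: s => [|a s IH].
    by rewrite (_ : [set _ | _] = setT)//; apply/seteqP; split.
  rewrite (_ : [set _ | _] = X a @^-1` (B a) `&`
    [set w | forall i, i \in s -> B i (X i w)]).
    by apply: measurableI => //; exact: measurable_funPTI.
  apply/seteqP; split => w /=.
    by move=> H; split=> [|i si]; apply: H; rewrite in_cons ?eqxx// si orbT.
  by move=> [Ha Hs] i; rewrite in_cons => /orP[/eqP->//|]; exact: Hs.
elim=> [|n IH] A s B mA us sn mB.
  have S0 : partial_sum X 0 = cst 0%R.
    by apply/funext => w; rewrite /partial_sum big_ord0.
  rewrite S0 preimage_cst; case: ifPn => _.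
    by rewrite setTI probability_setT mul1e.
  by rewrite set0I !measure0 mul0e.
have step (s' : seq nat) : uniq s' -> (forall i, i \in s' -> (n < i)%N) ->
  P (partial_sum X n.+1 @^-1` A `&` [set w | forall i, i \in s' -> B i (X i w)]) =
  (pushforward P (partial_sum X n) \x pushforward P (X n))
     [set z | A (z.1 + z.2)%R] * P [set w | forall i, i \in s' -> B i (X i w)].
  move=> us' s'n.
  rewrite -joint_law_eq_product//.
  - congr (P (_ `&` _)); apply/seteqP; split => w /=; rewrite partial_sumS//.
  - exact: partial_sum_measurable.
  - exact: mE.
  - move=> C D mC mD.
    pose B' i := if i == n then D else B i.
    have mB' i : measurable (B' i) by rewrite /B'; case: ifP.
    have ns' : n \notin s' by apply/negP => /s'n; rewrite ltnn.
    have E1 : [set w | forall i, i \in s' -> B i (X i w)] =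
              [set w | forall i, i \in s' -> B' i (X i w)].
      apply/seteqP; split => w /= H i si; have := H i si; rewrite /B';
        case: eqP => // E; by rewrite E (negPf ns') in si.
    have E2 : X n @^-1` D `&` [set w | forall i, i \in s' -> B i (X i w)] =
              [set w | forall i, i \in n :: s' -> B' i (X i w)].
      rewrite E1; apply/seteqP; split => w /=.
        move=> [Dn H] i; rewrite in_cons => /orP[/eqP ->|/H//].
        by rewrite /B' eqxx.
      move=> H; split.
        by have := H n; rewrite /B' eqxx mem_head; apply.
      by move=> i si; apply: H; rewrite in_cons si orbT.
    rewrite -setIA E2 IH//.
    + rewrite -muleA; congr (_ * _).
      rewrite indX//; last by rewrite /= ns'.
      rewrite big_cons E1 indX//; congr (_ * _).
      by rewrite /B' eqxx.
    + by rewrite /= ns'.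
    + by move=> i; rewrite in_cons => /orP[/eqP ->//|/s'n/ltnW].
  - have mad : measurable_fun setT (fun z : R * R => (z.1 + z.2)%R).
      by apply: measurable_funD; [exact: measurable_fst|exact: measurable_snd].
    by rewrite -[X in measurable X]setTI; exact: mad.
rewrite step//; congr (_ * _).
have := step [::] isT.
rewrite (_ : [set w | forall i, i \in [::] -> _] = setT).
  by rewrite setIT probability_setT mule1 => ->.
by apply/seteqP; split.
Qed.

Lemma integral_partial_sumS (X : nat -> {RV P >-> R}) (n : nat) (u : R -> R) :
  mutually_independent X -> measurable_fun setT u -> (forall x, 0 <= u x)%R ->
  \int[P]_w (u (partial_sum X n.+1 w))%:E =
  \int[P]_w \int[P]_w' (u (partial_sum X n w + X n w')%R)%:E.
Proof.
move=> indX mu u0.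
have mS := partial_sum_measurable X n.
pose S' : {mfun T >-> R} := HB.pack (partial_sum X n) (isMeasurableFun.Build _ _ _ _ _ mS).
have mSX : measurable_fun setT (fun w => (partial_sum X n w, X n w)).
  exact: measurable_fun_pair.
pose SX : {mfun T >-> (R * R)%type} :=
  HB.pack (fun w => (partial_sum X n w, X n w)) (isMeasurableFun.Build _ _ _ _ _ mSX).
have mad : measurable_fun setT (fun z : R * R => (u (z.1 + z.2)%R)%:E).
  apply/measurable_EFinP; apply: measurableT_comp => //.
  by apply: measurable_funD; [exact: measurable_fst|exact: measurable_snd].
transitivity (\int[distribution P S' \x distribution P (X n)]_z (u (z.1 + z.2)%R)%:E).
  rewrite (eq_measure_integral (distribution P SX)).
    rewrite ge0_integral_distribution//=; last by move=> y; rewrite lee_fin.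
    by apply: eq_integral => w _ /=; rewrite partial_sumS.
  move=> Z mZ _.
  rewrite -[LHS]mule1 -(probability_setT P) -joint_law_eq_product ?setIT//.
  move=> A B mA mB; rewrite setIT probability_setT mule1.
  have := @partial_sum_indep X indX n A [:: n] (fun _ => B) mA isT.
  rewrite (_ : [set w | forall i, i \in [:: n] -> _] = X n @^-1` B).
    by apply => // i; rewrite inE => /eqP ->.
  apply/seteqP; split => w /=; first by apply; rewrite mem_head.
  by move=> H i; rewrite inE => /eqP ->.
rewrite fubini_tonelli1//=; last by move=> z; rewrite lee_fin.
rewrite /fubini_F/= (@ge0_integral_distribution _ _ _ _ _ P S')//; last 2 first.
- apply: (measurable_fun_fubini_tonelli_F (m2 := distribution P (X n))
    (fun z : R * R => (u (z.1 + z.2)%R)%:E)) => // z.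
  by rewrite lee_fin.
- by move=> y; apply: integral_ge0 => z _; rewrite lee_fin.
apply: eq_integral => w _ /=.
rewrite ge0_integral_distribution//.
- apply/measurable_EFinP; apply: measurableT_comp => //.
  exact: measurable_funD.
- by move=> y; rewrite lee_fin.
Qed.

End independence.

(** * Super- and subsolutions of the renewal equation *)
Section comparison.
Context {d : measure_display} {T : measurableType d} {R : realType}.
Variable P : probability T R.
Local Open Scope ereal_scope.
Variables (X : nat -> {RV P >-> R}) (W : {RV P >-> R}) (rho x : R).
Hypothesis (iidX : iid X) (X0 : forall n w, (0 <= X n w)%R).
Hypothesis (rho01 : (0 < rho < 1)%R).

Lemma same_law_integral (Y Z : {RV P >-> R}) (f : R -> \bar R) :
  same_law Y Z -> measurable_fun setT f -> (forall y, 0 <= f y) ->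
  \int[P]_w f (Y w) = \int[P]_w f (Z w).
Proof.
move=> YZ mf f0.
rewrite -(ge0_integral_distribution Y mf f0) -(ge0_integral_distribution Z mf f0).
by apply: eq_measure_integral => A mA _; exact: YZ.
Qed.

Lemma tail_probability (Y : {RV P >-> R}) (t : R) : (tail Y t)%:E = P [set w | (t < Y w)%R].
Proof.
rewrite /tail fineK; last by rewrite fin_num_measure.
by rewrite /ccdf /distribution /pushforward/=; congr (P _); apply/seteqP; split => w /=;
  rewrite in_itv/= andbT.
Qed.

Lemma tail_ge0 (Y : {RV P >-> R}) (t : R) : (0 <= tail Y t)%R.
Proof. by rewrite -lee_fin tail_probability. Qed.

Lemma tail_le1 (Y : {RV P >-> R}) (t : R) : (tail Y t <= 1)%R.
Proof.
rewrite -lee_fin /tail fineK; last by rewrite fin_num_measure.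
exact: probability_le1.
Qed.

Lemma measurable_partial_sum_gt n : measurable [set w | (x < partial_sum X n w)%R].
Proof.
rewrite (_ : [set _ | _] = partial_sum X n @^-1` `]x, +oo[%classic).
  by rewrite -[X in measurable X]setTI; exact: partial_sum_measurable.
by apply/seteqP; split => w /=; rewrite in_itv/= andbT.
Qed.

Lemma measurable_partial_sum_indic (c : R) n :
  measurable_fun setT (fun w => (c * (x < partial_sum X n w)%R%:R)%:E).
Proof.
apply/measurable_EFinP/measurable_funM => //.
rewrite (_ : (fun w => _) = \1_[set w | (x < partial_sum X n w)%R]).
  exact/measurable_indic/measurable_partial_sum_gt.
by apply/funext => w; rewrite indicE/= mem_setE.
Qed.

Definition geometric_mixture N :=
  \sum_(0 <= n < N) ((1 - rho) * rho ^+ n)%:E * P [set w | (x < partial_sum X n w)%R].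

Let rho0 : (0 <= rho)%R. Proof. by case/andP: rho01 => /ltW. Qed.
Let eps0 : (0 <= 1 - rho)%R. Proof. by case/andP: rho01 => _ /ltW; rewrite subr_ge0. Qed.

Let coef0 n : (0 <= (1 - rho) * rho ^+ n)%R.
Proof. by rewrite mulr_ge0// exprn_ge0. Qed.

Lemma geometric_mixture_cvg : (0 <= x)%R -> pollaczek_khintchine rho X W ->
  geometric_mixture N @[N --> \oo] --> (tail W x)%:E.
Proof.
move=> x0 /(_ x x0) H.
rewrite /tail fineK; last by rewrite fin_num_measure.
rewrite H.
by apply: is_cvg_ereal_nneg_natsum => n _; rewrite mule_ge0// lee_fin.
Qed.

Variable u : R -> R.
Hypotheses (u_meas : measurable_fun setT u) (u0 : forall s, (0 <= u s)%R).

Definition step_mean (s : R) : \bar R := \int[P]_w (u (s + X 0%N w))%:E.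

Let a n := \int[P]_w (u (partial_sum X n w))%:E.

Lemma measurable_step_mean : measurable_fun setT step_mean.
Proof.
have mad : measurable_fun setT (fun z : R * T => (u (z.1 + X 0%N z.2)%R)%:E).
  apply/measurable_EFinP; apply: measurableT_comp => //.
  apply: measurable_funD; first exact: measurable_fst.
  by apply: measurableT_comp => //; exact: measurable_snd.
by apply: (measurable_fun_fubini_tonelli_F (m2 := P) _ mad) => z; rewrite lee_fin.
Qed.

Lemma step_mean_ge0 s : 0 <= step_mean s.
Proof. by apply: integral_ge0 => w _; rewrite lee_fin. Qed.

Let aS n : a n.+1 = \int[P]_w step_mean (partial_sum X n w).
Proof.
rewrite /a integral_partial_sumS//; last by case: iidX.
apply: eq_integral => w _; rewrite /step_mean.
apply: (@same_law_integral (X n) (X 0%N) (fun t => (u (partial_sum X n w + t))%:E)).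
- by case: iidX => _; exact.
- apply/measurable_EFinP; apply: measurableT_comp => //.
  exact: measurable_funD.
- by move=> y; rewrite lee_fin.
Qed.

Let a0 : a 0%N = (u 0%R)%:E.
Proof.
rewrite /a (eq_integral (fun _ => (u 0%R)%:E)).
  by rewrite integral_cst// -[RHS]mule1; congr (_ * _); exact: probability_setT.
by move=> w _; rewrite /partial_sum big_ord0.
Qed.

Let a_ge0 n : 0 <= a n.
Proof. by apply: integral_ge0 => w _; rewrite lee_fin. Qed.

Let partial_sum_ge0 n w : (0 <= partial_sum X n w)%R.
Proof. by apply: sumr_ge0. Qed.

(** One step of the walk, integrated over the position S_n. *)
Let mix n : (1 - rho)%:E * P [set w | (x < partial_sum X n w)%R] + rho%:E * a n.+1 =
  \int[P]_w (((1 - rho) * (x < partial_sum X n w)%R%:R)%:E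
              + rho%:E * step_mean (partial_sum X n w)).
Proof.
have m1 : measurable_fun setT (fun w => ((1 - rho) * (x < partial_sum X n w)%R%:R)%:E).
  exact: measurable_partial_sum_indic.
have m2 : measurable_fun setT (fun w => step_mean (partial_sum X n w)).
  apply: measurableT_comp; first exact: measurable_step_mean.
  exact: partial_sum_measurable.
rewrite ge0_integralD//=.
- congr (_ + _).
    rewrite -[in LHS](setIT [set w | (x < partial_sum X n w)%R]).
    rewrite -integral_indic//; last exact: measurable_partial_sum_gt.
    rewrite -ge0_integralZl_EFin//=.
    by apply: eq_integral => w _; rewrite indicE mem_setE -EFinM.
    exact/measurable_EFinP/measurable_indic/measurable_partial_sum_gt.
  rewrite aS -ge0_integralZl_EFin//= => w _; exact: step_mean_ge0.
- by move=> w _; rewrite lee_fin mulr_ge0.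
- by move=> w _; rewrite mule_ge0// ?lee_fin// step_mean_ge0.
- apply: emeasurable_funM => //; exact: measurable_cst.
Qed.

(** The running reward collected up to step N, plus the discounted potential b
    still to be collected, unfolds by one step of the relation; its monotonicity
    in N is what the comparison principles rest on. *)
Lemma geometric_mixtureS N (b : \bar R) : 0 <= b ->
  geometric_mixture N.+1 + (rho ^+ N.+1)%:E * b =
  geometric_mixture N + (rho ^+ N)%:E *
     ((1 - rho)%:E * P [set w | (x < partial_sum X N w)%R] + rho%:E * b).
Proof.
move=> b0; rewrite /geometric_mixture big_nat_recr//= -addeA; congr (_ + _).
rewrite ge0_muleDr; last 2 first.
- by rewrite mule_ge0// lee_fin.
- by rewrite mule_ge0// lee_fin.
by rewrite !muleA -!EFinM exprSr (mulrC (1 - rho)%R).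
Qed.

Let geometric_mixture0 : geometric_mixture 0 + (rho ^+ 0)%:E * a 0%N = (u 0%R)%:E.
Proof. by rewrite /geometric_mixture big_nil add0e expr0 mul1e a0. Qed.

(** Each step trades potential for reward at a loss, so the reward ever
    collected, which is P(W > x), is at most the initial potential. *)
Lemma tail_le_supersolution :
  (0 <= x)%R -> pollaczek_khintchine rho X W ->
  (forall s, (0 <= s)%R ->
    ((1 - rho) * (x < s)%R%:R)%:E + rho%:E * step_mean s <= (u s)%:E) ->
  (tail W x <= u 0)%R.
Proof.
move=> x0 PK H.
have key N : geometric_mixture N + (rho ^+ N)%:E * a N <= (u 0%R)%:E.
  elim: N => [|N IH]; first by rewrite geometric_mixture0.
  rewrite geometric_mixtureS//; apply: le_trans IH.
  rewrite leeD2l// lee_wpmul2l ?lee_fin ?exprn_ge0//.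
  rewrite mix; apply: ge0_le_integral => //.
  - move=> w _; rewrite adde_ge0// ?mule_ge0 ?lee_fin ?mulr_ge0//.
    exact: step_mean_ge0.
  - apply: emeasurable_funD.
      exact: measurable_partial_sum_indic.
    apply: emeasurable_funM => //; apply: measurableT_comp; first exact: measurable_step_mean.
    exact: partial_sum_measurable.
  - apply/measurable_EFinP; apply: measurableT_comp => //.
    exact: partial_sum_measurable.
  - by move=> w _; exact: H.
rewrite -lee_fin; apply: (cvge_to_le (geometric_mixture_cvg x0 PK)).
near=> N; apply: le_trans (key N).
by rewrite leeDl// mule_ge0// lee_fin exprn_ge0.
Unshelve. all: by end_near. Qed.

(** Dually; boundedness of u makes the discounted potential left after N steps
    vanish, as it is at most rho^N. *)
Lemma tail_ge_subsolution :
  (0 <= x)%R -> pollaczek_khintchine rho X W -> (forall s, (u s <= 1)%R) ->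
  (forall s, (0 <= s)%R ->
    (u s)%:E <= ((1 - rho) * (x < s)%R%:R)%:E + rho%:E * step_mean s) ->
  (u 0 <= tail W x)%R.
Proof.
move=> x0 PK u1 H.
have a_le1 n : a n <= 1.
  rewrite -(probability_setT P) -[leRHS]mul1e -integral_cst//.
  apply: ge0_le_integral => //.
  - by move=> w _; rewrite lee_fin.
  - apply/measurable_EFinP; apply: measurableT_comp => //.
    exact: partial_sum_measurable.
  - by move=> w _; rewrite lee_fin.
have key N : (u 0%R)%:E <= geometric_mixture N + (rho ^+ N)%:E * a N.
  elim: N => [|N IH]; first by rewrite geometric_mixture0.
  rewrite geometric_mixtureS//; apply: (le_trans IH).
  rewrite leeD2l// lee_wpmul2l ?lee_fin ?exprn_ge0//.
  rewrite mix; apply: ge0_le_integral => //.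
  - by move=> w _; rewrite lee_fin.
  - apply/measurable_EFinP; apply: measurableT_comp => //.
    exact: partial_sum_measurable.
  - apply: emeasurable_funD.
      exact: measurable_partial_sum_indic.
    apply: emeasurable_funM => //; apply: measurableT_comp; first exact: measurable_step_mean.
    exact: partial_sum_measurable.
  - by move=> w _; exact: H.
rewrite -lee_fin -[leRHS]adde0.
have cv : geometric_mixture N + (rho ^+ N)%:E @[N --> \oo] --> (tail W x)%:E + 0%:E.
  apply: cvgeD => //; first exact: geometric_mixture_cvg.
  apply: cvg_EFin; first exact: nearW.
  apply: cvg_expr; rewrite ger0_norm//; by case/andP: rho01.
apply: (cvge_to_ge cv).
near=> N; apply: (le_trans (key N)).
by rewrite leeD2l// -[leRHS]mule1 lee_wpmul2l// lee_fin exprn_ge0.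
Unshelve. all: by end_near. Qed.

End comparison.

(** * Explicit bounds on the tail of a geometric sum *)

Ltac nneg := repeat match goal with
  | |- is_true true => by []
  | H : is_true ?g |- is_true ?g => exact: H
  | |- is_true (0 <= _ + _) => apply: addr_ge0
  | |- is_true (0 <= _ / _) => apply: divr_ge0
  | |- is_true (0 <= _ * _) => apply: mulr_ge0
  | |- is_true (0 <= expR _) => apply: expR_ge0
  | |- is_true (0 <= _) => by []
  end.

Section bounds.
Context {d : measure_display} {T : measurableType d} {R : realType}.
Variable P : probability T R.

Lemma ge0_integral_affine (c : R) (f g : T -> R) :
  measurable_fun setT f -> measurable_fun setT g ->
  0 <= c -> (forall w, 0 <= f w) -> (forall w, 0 <= g w) ->
  (\int[P]_w (c * f w + g w)%:E = c%:E * \int[P]_w (f w)%:E + \int[P]_w (g w)%:E)%E.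
Proof.
move=> mf mg c0 f0 g0.
under eq_integral do rewrite EFinD EFinM.
rewrite ge0_integralD//=.
- rewrite ge0_integralZl_EFin//=.
    by move=> w _; rewrite lee_fin.
  exact/measurable_EFinP.
- by move=> w _; rewrite lee_fin mulr_ge0.
- by apply/measurable_EFinP; apply: measurable_funM.
- by move=> w _; rewrite lee_fin.
- exact/measurable_EFinP.
Qed.

Lemma integral_cst_probability (c : R) : (\int[P]_w c%:E = c%:E)%E.
Proof.
by rewrite integral_cst// -[RHS]mule1; congr (_ * _)%E; exact: probability_setT.
Qed.

Lemma measurable_gt_natr (Y : {RV P >-> R}) (t : R) :
  measurable_fun setT (fun w => (t < Y w)%R%:R : R).
Proof.
rewrite (_ : (fun w => _) = \1_[set w | t < Y w]).
  apply: measurable_indic.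
  rewrite (_ : [set _ | _] = Y @^-1` `]t, +oo[%classic); first exact: measurable_funPTI.
  by apply/seteqP; split => w /=; rewrite in_itv/= andbT.
by apply/funext => w; rewrite indicE/= mem_setE.
Qed.

Lemma integral_gt_natr (Y : {RV P >-> R}) (t : R) :
  (\int[P]_w ((t < Y w)%R%:R)%:E = (tail Y t)%:E)%E.
Proof.
rewrite tail_probability -[in RHS](setIT [set w | t < Y w]) -integral_indic//.
  by apply: eq_integral => w _; rewrite indicE mem_setE.
rewrite (_ : [set _ | _] = Y @^-1` `]t, +oo[%classic); first exact: measurable_funPTI.
by apply/seteqP; split => w /=; rewrite in_itv/= andbT.
Qed.

Section tail_bounds.
Variables (X : nat -> {RV P >-> R}) (W : {RV P >-> R}) (rho x : R).
Hypothesis (iidX : iid X) (X0 : forall n w, 0 <= X n w).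
Hypothesis (rho01 : 0 < rho < 1) (x0 : 0 <= x).
Hypothesis (PK : pollaczek_khintchine rho X W).
Local Notation Y := (X 0%N).
Local Notation H := (tail Y).
Local Notation eps := (1 - rho).

(** The hypothesis on s and t says how exp (theta (s + t - x)), capped at 1, is
    paid for after a jump t from the position s: by exponential growth with the
    jump capped at b, by a fixed price for jumps above a or above b, and by a
    price proportional to s for jumps above b.  The latter, integrated along
    the walk, produces the term with E[S_N] / eps, that is, with mu / eps^2. *)
Lemma tail_le_potential (mu theta a b lam nu : R) :
  ('E_P[Y] = mu%:E)%E -> 0 <= theta -> 0 <= lam -> 0 <= nu ->
  (rho%:E * \int[P]_w (expR (theta * Num.min (Y w) b))%:E <= 1)%E ->
  (forall s t : R, 0 <= s -> s <= x -> 0 <= t ->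
    Num.min 1 (expR (theta * (s + t - x))) <=
    expR (theta * (s - x)) * expR (theta * Num.min t b) + (a < t)%R%:R
      + (lam + nu * s) * (b < t)%R%:R) ->
  tail W x <= expR (- (theta * x)) + rho / eps * (H a + lam * H b)
              + nu * H b * (rho ^+ 2 * mu / eps ^+ 2).
Proof.
move=> EY th0 lam0 nu0 mgf Hst.
have /andP[r0 r1] := rho01.
have e0 : 0 < eps by rewrite subr_gt0.
have r0' := ltW r0; have e0' := ltW e0.
have Ha0 : 0 <= H a by exact: tail_ge0.
have Hb0 : 0 <= H b by exact: tail_ge0.
have mu0 : 0 <= mu.
  by rewrite -lee_fin -EY; apply: expectation_ge0.
(* The affine correction k + l s solves exactly the one-step relation whose
   source is the price of the large jumps. *)
pose l := rho * H b * nu / eps.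
pose k := (rho * (H a + lam * H b) + rho * l * mu) / eps.
have l0 : 0 <= l by rewrite /l; nneg.
have k0 : 0 <= k.
  by rewrite /k; nneg.
pose u s := Num.min 1 (expR (theta * (s - x))) + (k + l * Num.max s 0).
have u0 s : 0 <= u s.
  apply: addr_ge0; first by rewrite le_min ler01/= expR_ge0.
  by rewrite addr_ge0// mulr_ge0// le_max lexx orbT.
have mu_ : measurable_fun setT u.
  apply: measurable_funD.
    apply: measurable_minr => //; apply: measurableT_comp => //.
    by apply: measurable_funM => //; apply: measurable_funB.
  apply: measurable_funD => //; apply: measurable_funM => //.
  exact: measurable_maxr.
have key : tail W x <= u 0.
  apply: (@tail_le_supersolution _ _ _ _ X _ rho) => // s s0.
  have [sx|xs] := leP s x; last first.
    (* Above the level x, the cap 1 of the potential pays for the reward eps. *)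
    have B : (step_mean X u s <= (l * mu + (1 + k + l * s))%:E)%E.
      rewrite EFinD EFinM -EY unlock -[X in (_ <= _ + X)%E]integral_cst_probability.
      rewrite -ge0_integral_affine//; last first.
        by move=> w; rewrite !addr_ge0// mulr_ge0.
      apply: ge0_le_integral => //.
      + by move=> w _; rewrite lee_fin.
      + apply/measurable_EFinP; apply: measurableT_comp => //; exact: measurable_funD.
      + apply/measurable_EFinP; apply: measurable_funD => //; exact: measurable_funM.
      + move=> w _; rewrite lee_fin /u.
        have sY : 0 <= s + X 0%N w by rewrite addr_ge0.
        rewrite (max_idPl sY).
        have : Num.min 1 (expR (theta * (s + X 0%N w - x))) <= 1 by rewrite ge_min lexx.
        lra.
    apply: (@le_trans _ _ ((eps * 1)%:E + rho%:E * (l * mu + (1 + k + l * s))%:E)%E).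
      apply: leeD; last by rewrite lee_wpmul2l// lee_fin ltW.
      by [].
    rewrite -EFinM -EFinD lee_fin /u (max_idPl s0).
    have -> : Num.min 1 (expR (theta * (s - x))) = 1.
      by apply/min_idPl; rewrite -[leLHS]expR0 ler_expR mulr_ge0// subr_ge0 ltW.
    have : eps * k = rho * (H a + lam * H b) + rho * l * mu.
      by rewrite /k mulrC divfK// gt_eqF.
    have : 0 <= rho * (H a + lam * H b) by nneg.
    have : 0 <= eps * (l * s) by nneg.
    nra.
  have B : (rho%:E * step_mean X u s <=
     (expR (theta * (s - x)) + rho * (H a + (lam + nu * s) * H b + (l * mu + (k + l * s))))%:E)%E.
    pose E1 := expR (theta * (s - x)).
    have E10 : 0 <= E1 by exact: expR_ge0.
    have ls0 : 0 <= lam + nu * s by rewrite addr_ge0// mulr_ge0.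
    apply: (@le_trans _ _ (rho%:E * \int[P]_w (E1 * expR (theta * Num.min (Y w) b) +
       (1 * (a < Y w)%R%:R + ((lam + nu * s) * (b < Y w)%R%:R + (l * Y w + (k + l * s)))))%:E)%E).
      rewrite lee_wpmul2l//.
      apply: ge0_le_integral => //.
      + by move=> w _; rewrite lee_fin.
      + apply/measurable_EFinP; apply: measurableT_comp => //; exact: measurable_funD.
      + apply/measurable_EFinP; apply: measurable_funD.
          apply: measurable_funM => //; apply: measurableT_comp => //.
          by apply: measurable_funM => //; apply: measurable_minr.
        apply: measurable_funD; first by apply: measurable_funM => //; exact: measurable_gt_natr.
        apply: measurable_funD; first by apply: measurable_funM => //; exact: measurable_gt_natr.
        by apply: measurable_funD => //; exact: measurable_funM.
      + move=> w _; rewrite lee_fin /u.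
        have sY : 0 <= s + X 0%N w by rewrite addr_ge0.
        rewrite (max_idPl sY).
        have := Hst s (Y w) s0 sx (X0 _ _); rewrite -/E1; lra.
    have mexp : measurable_fun setT (fun w => expR (theta * Num.min (Y w) b)).
      apply: measurableT_comp => //.
      by apply: measurable_funM => //; apply: measurable_minr.
    have mlin : measurable_fun setT (fun w => l * Y w + (k + l * s)).
      by apply: measurable_funD => //; exact: measurable_funM.
    have mb : measurable_fun setT (fun w => (lam + nu * s) * (b < Y w)%R%:R + (l * Y w + (k + l * s))).
      by apply: measurable_funD => //; apply: measurable_funM => //; exact: measurable_gt_natr.
    have ma : measurable_fun setT (fun w => 1 * (a < Y w)%R%:R + ((lam + nu * s) * (b < Y w)%R%:R + (l * Y w + (k + l * s)))).
      by apply: measurable_funD => //; apply: measurable_funM => //; exact: measurable_gt_natr.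
    have kls : 0 <= k + l * s by rewrite addr_ge0// mulr_ge0.
    have plin w : 0 <= l * Y w + (k + l * s) by rewrite addr_ge0// mulr_ge0.
    have pb w : 0 <= (lam + nu * s) * (b < Y w)%R%:R + (l * Y w + (k + l * s)).
      by rewrite addr_ge0// mulr_ge0.
    have pa w : 0 <= 1 * (a < Y w)%R%:R + ((lam + nu * s) * (b < Y w)%R%:R + (l * Y w + (k + l * s))).
      by rewrite addr_ge0// mulr_ge0.
    have pe w : 0 <= expR (theta * Num.min (Y w) b) by exact: expR_ge0.
    rewrite ge0_integral_affine// ge0_integral_affine//; last exact: measurable_gt_natr.
    rewrite ge0_integral_affine//; last exact: measurable_gt_natr.
    rewrite ge0_integral_affine// !integral_gt_natr integral_cst_probability.
    have -> : (\int[P]_w (Y w)%:E = mu%:E)%E by rewrite -EY unlock.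
    rewrite -!EFinM -!EFinD mul1r.
    rewrite ge0_muleDr; last 2 first.
    - by rewrite mule_ge0// ?lee_fin//; apply: integral_ge0 => w _; rewrite lee_fin.
    - by rewrite lee_fin; nneg.
    rewrite muleCA -EFinM [in leRHS]EFinD; apply: leeD; last by rewrite lee_fin !addrA.
    by rewrite -[leRHS]mule1 lee_wpmul2l.
  rewrite mulr0 add0e; apply: (le_trans B).
  rewrite lee_fin /u (max_idPl s0).
  have -> : Num.min 1 (expR (theta * (s - x))) = expR (theta * (s - x)).
    by apply/min_idPr; rewrite -[leRHS]expR0 ler_expR mulr_ge0_le0// subr_le0.
  have Ek : eps * k = rho * (H a + lam * H b) + rho * l * mu.
    by rewrite /k mulrC divfK// gt_eqF.
  have El : eps * l = rho * H b * nu by rewrite /l mulrC divfK// gt_eqF.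
  have Els : eps * (l * s) = rho * H b * nu * s by rewrite mulrA El.
  rewrite lerD2l; nra.
apply: (le_trans key); rewrite /u maxxx sub0r mulr0 addr0 mulrN.
have -> : k = rho / eps * (H a + lam * H b) + nu * H b * (rho ^+ 2 * mu / eps ^+ 2).
  by rewrite /k /l; field; rewrite gt_eqF.
by rewrite addrA !lerD2r ge_min lexx orbT.
Qed.

(** Overshoot is controlled by giving a reserve b to the potential: a jump capped
    at b from below x never takes exp (theta (s - x - b)) above 1. *)
Lemma tail_ge_capped_exponential (theta b : R) : 0 <= theta -> 0 <= b ->
  (1 <= rho%:E * \int[P]_w (expR (theta * Num.min (Y w) b))%:E)%E ->
  expR (- (theta * (x + b))) <= tail W x.
Proof.
move=> th0 b0 mgf.
have /andP[r0 r1] := rho01.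
have e0 : 0 < eps by rewrite subr_gt0.
pose u s := if s <= x then expR (theta * (s - x - b)) else 1.
have u0 s : 0 <= u s by rewrite /u; case: ifP => // _; exact: expR_ge0.
have u1 s : u s <= 1.
  rewrite /u; case: ifP => // sx; rewrite -[leRHS]expR0 ler_expR mulr_ge0_le0//.
  lra.
have mu_ : measurable_fun setT u.
  apply: measurable_fun_ifT => //.
    exact: measurable_fun_ler.
  apply: measurableT_comp => //; apply: measurable_funM => //.
  by do 2 apply: measurable_funB => //.
have mexp : measurable_fun setT (fun w => expR (theta * Num.min (Y w) b)).
  apply: measurableT_comp => //.
  by apply: measurable_funM => //; apply: measurable_minr.
have -> : - (theta * (x + b)) = theta * (0 - x - b) by ring.
have -> : expR (theta * (0 - x - b)) = u 0 by rewrite /u x0.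
apply: (@tail_ge_subsolution _ _ _ _ X _ rho) => // s s0.
have [sx|xs] := leP s x; last first.
  have -> : step_mean X u s = 1%E.
    rewrite -(integral_cst_probability 1); apply: eq_integral => w _.
    rewrite /u leNgt (lt_le_trans xs)//=.
    by rewrite lerDl.
  by rewrite mulr1 mule1 -EFinD lee_fin (le_trans (u1 s))//; lra.
rewrite mulr0 add0e /u sx.
apply: (@le_trans _ _ ((expR (theta * (s - x - b)))%:E *
  (rho%:E * \int[P]_w (expR (theta * Num.min (Y w) b))%:E))%E).
  by rewrite -[leLHS]mule1 lee_wpmul2l// lee_fin expR_ge0.
rewrite muleCA lee_wpmul2l//; first by rewrite lee_fin ltW.
rewrite -ge0_integralZl_EFin ?expR_ge0//; last first.
  exact/measurable_EFinP.
apply: ge0_le_integral => //.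
- by apply/measurable_EFinP; apply: measurable_funM.
- apply/measurable_EFinP; apply: (measurableT_comp mu_); exact: measurable_funD.
move=> w _; rewrite -EFinM lee_fin -expRD -mulrDr /u.
have [Yb|Yb] := leP (Y w) b; case: ifPn => sYx.
- by rewrite ler_expR ler_wpM2l//; lra.
- by rewrite -[leRHS]expR0 ler_expR mulr_ge0_le0//; lra.
- by rewrite ler_expR ler_wpM2l//; lra.
- by rewrite -[leRHS]expR0 ler_expR mulr_ge0_le0//; lra.
Qed.

(** Only the event that a single term exceeds x is retained; the constant c below
    x is its probability along the geometric number of terms. *)
Lemma tail_ge_big_jump :
  rho * H x / (eps + rho * H x) <= tail W x.
Proof.
have /andP[r0 r1] := rho01.
have e0 : 0 < eps by rewrite subr_gt0.
have Hx0 : 0 <= H x by exact: tail_ge0.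
have Hx1 : H x <= 1 by exact: tail_le1.
have rH : 0 <= rho * H x by rewrite mulr_ge0// ltW.
have den0 : 0 < eps + rho * H x by rewrite ltr_pwDl.
pose c := rho * H x / (eps + rho * H x).
have c0 : 0 <= c by rewrite divr_ge0// ltW.
have c1 : c <= 1 by rewrite ler_pdivrMr// mul1r lerDr ltW.
have cE : c * (eps + rho * H x) = rho * H x by rewrite divfK// gt_eqF.
pose u s := if s <= x then c else 1.
have u0 s : 0 <= u s by rewrite /u; case: ifP.
have u1 s : u s <= 1 by rewrite /u; case: ifP.
have mu_ : measurable_fun setT u.
  by apply: measurable_fun_ifT => //; exact: measurable_fun_ler.
rewrite -/c; have -> : c = u 0 by rewrite /u x0.
apply: (@tail_ge_subsolution _ _ _ _ X _ rho) => // s s0.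
have [sx|xs] := leP s x; last first.
  have -> : step_mean X u s = 1%E.
    rewrite -(integral_cst_probability 1); apply: eq_integral => w _.
    by rewrite /u leNgt (lt_le_trans xs)//= lerDl.
  by rewrite mulr1 mule1 -EFinD lee_fin (le_trans (u1 s))//; lra.
rewrite mulr0 add0e /u sx.
apply: (@le_trans _ _ (rho%:E * \int[P]_w ((1 - c) * (x < Y w)%R%:R + c)%:E)%E).
  rewrite ge0_integral_affine//; last 2 first.
  - exact: measurable_gt_natr.
  - by rewrite subr_ge0.
  rewrite integral_gt_natr integral_cst_probability -!(EFinM, EFinD) lee_fin.
  nra.
rewrite lee_wpmul2l//; first by rewrite lee_fin ltW.
apply: ge0_le_integral => //.
- by move=> w _; rewrite lee_fin addr_ge0// mulr_ge0// subr_ge0.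
- apply/measurable_EFinP; apply: measurable_funD => //; apply: measurable_funM => //.
  exact: measurable_gt_natr.
- apply/measurable_EFinP; apply: (measurableT_comp mu_); exact: measurable_funD.
move=> w _; rewrite lee_fin /u.
have := X0 0%N w; case: ifPn => h1; have [h2|h2] := ltP x (Y w) => /= h3; rewrite ?mulr1 ?mulr0 ?subrK ?add0r//.
lra.
Qed.

End tail_bounds.
End bounds.

(** * Moments and truncated moment generating functions *)
Section moments.
Context {d : measure_display} {T : measurableType d} {R : realType}.
Variable P : probability T R.

(** Multiply exp z (1 - z) <= 1 by 1 + z. *)
Lemma expR_le_quadratic (z : R) : 0 <= z -> expR z <= 1 + z + z ^+ 2 * expR z.
Proof.
move=> z0; have : expR z * (1 - z) <= 1.
  have h : 1 - z <= expR (- z) by exact: expR_ge1Dx.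
  have := ler_wpM2l (expR_ge0 z) h.
  by rewrite -expRD subrr expR0.
have : 0 <= 1 + z by lra.
nra.
Qed.

(** Below 1 the power p <= 2 dominates the square; above 1 the last term alone
    dominates. *)
Lemma expR_le_powR (p z : R) : 1 <= p <= 2 -> 0 <= z ->
  expR z <= 1 + z + z `^ p * expR z.
Proof.
move=> /andP[p1 p2] z0; have [z1|z1] := leP z 1.
  apply: (le_trans (expR_le_quadratic z0)); rewrite lerD2l ler_wpM2r ?expR_ge0//.
  have [->|zn0] := eqVneq z 0; first by rewrite expr0n/= powR_ge0.
  have z0' : 0 < z by rewrite lt_neqAle eq_sym zn0.
  by rewrite -powR_mulrn// ger_powR// z0' z1.
have : 1 <= z `^ p by rewrite -[leLHS](powRr0 z) ler_powR ?(ltW z1)//; lra.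
have := expR_ge0 z; nra.
Qed.

Lemma measurable_powR_RV (Y : {RV P >-> R}) (p : R) :
  measurable_fun setT (fun w => Y w `^ p).
Proof. by apply: (measurableT_comp (measurable_powR p)); exact: measurable_funP. Qed.

Section truncation.
Variables (Y : {RV P >-> R}) (p mu M : R).
Hypothesis (Y0 : forall w, 0 <= Y w) (p12 : 1 <= p <= 2).
Hypothesis (EY : ('E_P[Y] = mu%:E)%E).
Hypothesis (EYp : (\int[P]_w (Y w `^ p)%:E = M%:E)%E).

Let p0 : 0 <= p. Proof. by case/andP: p12 => /(le_trans ler01). Qed.

Let EY' : (\int[P]_w (Y w)%:E = mu%:E)%E. Proof. by rewrite -EY unlock. Qed.

Lemma moment_ge0 : 0 <= M.
Proof. by rewrite -lee_fin -EYp; apply: integral_ge0 => w _; rewrite lee_fin powR_ge0. Qed.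

(** Only a moment of order p <= 2 is assumed since the second moment may be
    infinite; the error beyond the first-order term is of order theta^p. *)
Lemma mgf_truncated_le (theta b : R) : 0 <= theta -> 0 <= b ->
  (\int[P]_w (expR (theta * Num.min (Y w) b))%:E <=
   (1 + theta * mu + theta `^ p * M * expR (theta * b))%:E)%E.
Proof.
move=> th0 b0.
have c0 : 0 <= theta `^ p * expR (theta * b) by rewrite mulr_ge0 ?powR_ge0 ?expR_ge0.
have -> : (1 + theta * mu + theta `^ p * M * expR (theta * b))%:E =
   (\int[P]_w (theta `^ p * expR (theta * b) * Y w `^ p + (theta * Y w + 1))%:E)%E.
  rewrite ge0_integral_affine//.
  - rewrite ge0_integral_affine// EYp EY' integral_cst_probability -!EFinM -!EFinD.
    by congr EFin; ring.
  - exact: measurable_powR_RV.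
  - by apply: measurable_funD => //; exact: measurable_funM.
  - by move=> w; exact: powR_ge0.
  - by move=> w; rewrite addr_ge0// mulr_ge0.
apply: ge0_le_integral => //.
- apply/measurable_EFinP; apply: measurableT_comp => //.
  by apply: measurable_funM => //; apply: measurable_minr.
- apply/measurable_EFinP; apply: measurable_funD.
    by apply: measurable_funM => //; exact: measurable_powR_RV.
  by apply: measurable_funD => //; exact: measurable_funM.
move=> w _; rewrite lee_fin.
have m0 : 0 <= Num.min (Y w) b by rewrite le_min Y0.
have z0 : 0 <= theta * Num.min (Y w) b by rewrite mulr_ge0.
apply: (le_trans (expR_le_powR p12 z0)).
rewrite addrC; apply: lerD.
  rewrite powRM// -mulrA -[leRHS]mulrA ler_wpM2l ?powR_ge0// [leRHS]mulrC.
  apply: ler_pM; rewrite ?powR_ge0 ?expR_ge0//.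
    by apply: ge0_ler_powR; rewrite ?nnegrE// ge_min lexx.
  by rewrite ler_expR ler_wpM2l// ge_min lexx orbT.
by rewrite addrC lerD2r ler_wpM2l// ge_min lexx.
Qed.

(** The mean lost to the cap is at most E[Y; Y > b] <= b^(1 - p) E[Y^p]. *)
Lemma mgf_truncated_ge (theta b : R) : 0 <= theta -> 0 < b ->
  ((1 + theta * (mu - b `^ (1 - p) * M))%:E <=
   \int[P]_w (expR (theta * Num.min (Y w) b))%:E)%E.
Proof.
move=> th0 b0.
have c0 : 0 <= theta * b `^ (1 - p) by rewrite mulr_ge0 ?powR_ge0.
have mmin : measurable_fun setT (fun w => expR (theta * Num.min (Y w) b)).
  apply: measurableT_comp => //.
  by apply: measurable_funM => //; apply: measurable_minr.
have H : ((1 + theta * mu)%:E <=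
  (theta * b `^ (1 - p) * M)%:E + \int[P]_w (expR (theta * Num.min (Y w) b))%:E)%E.
  rewrite EFinM -EYp -ge0_integral_affine//; [|exact: measurable_powR_RV|by move=> w; exact: powR_ge0].
  have -> : (1 + theta * mu)%:E = (\int[P]_w (theta * Y w + 1)%:E)%E.
    by rewrite ge0_integral_affine// EY' integral_cst_probability -EFinM -EFinD addrC.
  apply: ge0_le_integral => //.
  - by move=> w _; rewrite lee_fin addr_ge0// mulr_ge0.
  - by apply/measurable_EFinP; apply: measurable_funD => //; exact: measurable_funM.
  - apply/measurable_EFinP; apply: measurable_funD => //.
    by apply: measurable_funM => //; exact: measurable_powR_RV.
  move=> w _; rewrite lee_fin.
  have := expR_ge1Dx (theta * Num.min (Y w) b).
  suff : theta * Y w <= theta * b `^ (1 - p) * Y w `^ p + theta * Num.min (Y w) b by lra.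
  rewrite -mulrA -mulrDr ler_wpM2l//.
  have [Yb|Yb] := leP (Y w) b; first by rewrite lerDr mulr_ge0// powR_ge0.
  rewrite -[leLHS]addr0; apply: lerD; last exact: ltW.
  have Yp : 0 < Y w by exact: lt_trans Yb.
  have YE : Y w = Y w `^ (1 - p) * Y w `^ p.
    by rewrite -powRD ?subrK ?powRr1 ?(ltW Yp)// (gt_eqF Yp) implybT.
  rewrite [leLHS]YE ler_wpM2r ?powR_ge0//.
  have q0 : 0 <= p - 1 by case/andP: p12; lra.
  rewrite -(opprB p 1) !powRN lef_pV2 ?posrE ?powR_gt0//.
  by rewrite ge0_ler_powR// ?nnegrE ltW.
have -> : 1 + theta * (mu - b `^ (1 - p) * M) = 1 + theta * mu - theta * b `^ (1 - p) * M.
  ring.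
by rewrite EFinB leeBlDl.
Qed.

Lemma tail_markov (t : R) : 0 < t -> tail Y t <= M * t `^ (- p).
Proof.
move=> t0.
have tp : 0 < t `^ p by exact: powR_gt0.
rewrite powRN ler_pdivlMr// mulrC -lee_fin EFinM -integral_gt_natr -EYp.
rewrite -ge0_integralZl_EFin ?powR_ge0//; last first.
  by apply/measurable_EFinP; exact: measurable_gt_natr.
apply: ge0_le_integral => //.
- by move=> w _; rewrite mule_ge0 ?lee_fin ?powR_ge0.
- apply/measurable_EFinP/measurable_funM => //; exact: measurable_gt_natr.
- by apply/measurable_EFinP; exact: measurable_powR_RV.
move=> w _; rewrite -EFinM lee_fin; have [tY|_] := ltP t (Y w).
  by rewrite mulr1 ge0_ler_powR// ?nnegrE ltW// (lt_trans t0).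
by rewrite mulr0 powR_ge0.
Qed.

End truncation.

Lemma geometric_sum_le (r c : R) N : 0 <= r < 1 -> 0 <= c ->
  \sum_(0 <= k < N) c * r ^+ k <= c / (1 - r).
Proof.
move=> /andP[r0 r1] c0.
have e0 : 0 < 1 - r by rewrite subr_gt0.
rewrite ler_pdivlMr//.
suff : (\sum_(0 <= k < N) c * r ^+ k) * (1 - r) + c * r ^+ N = c.
  have : 0 <= c * r ^+ N by rewrite mulr_ge0// exprn_ge0.
  lra.
elim: N => [|N IH]; first by rewrite big_nil mul0r expr0 mulr1 add0r.
rewrite big_nat_recr//= exprS -[RHS]IH; ring.
Qed.

Lemma dyadic_block (t0 t : R) : 0 < t0 -> t0 < t ->
  exists k : nat, 2 ^+ k * t0 < t <= 2 ^+ k.+1 * t0.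
Proof.
move=> t00 t0t.
have ex : exists n : nat, t <= 2 ^+ n * t0.
  exists (Num.truncn (t / t0)).+1.
  rewrite -ler_pdivrMr//; apply: (le_trans (ltW (truncnS_gt _))).
  by rewrite -natrX ler_nat ltnW// ltn_expl.
case: (ex_minnP ex) => -[|n]; first by rewrite expr0 mul1r leNgt t0t.
move=> h1 h2; exists n; rewrite h1 andbT ltNge; apply/negP => /h2.
by rewrite ltnn.
Qed.

(** Y^q is dominated by its values on dyadic blocks, and the tail bound turns the
    expectation of the latter into a geometric series of ratio 2^(q - a). *)
Lemma moment_finite (Y : {RV P >-> R}) (t0 C a q : R) : 0 < t0 -> 0 <= C ->
  0 < q -> q < a -> (forall w, 0 <= Y w) ->
  (forall t, t0 <= t -> tail Y t <= C * t `^ (- a)) ->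
  (\int[P]_w (Y w `^ q)%:E < +oo)%E.
Proof.
move=> t00 C0 q0 qa Y0 HC.
pose c k := (2 ^+ k.+1 * t0) `^ q.
have c0 k : 0 <= c k by exact: powR_ge0.
pose F k w : \bar R := (c k * (2 ^+ k * t0 < Y w)%R%:R)%:E.
have F0 k w : (0 <= F k w)%E by rewrite lee_fin mulr_ge0.
have mF k : measurable_fun setT (F k).
  by apply/measurable_EFinP/measurable_funM => //; exact: measurable_gt_natr.
pose B := (2 * t0) `^ q * C * t0 `^ (- a).
pose r : R := 2 `^ (q - a).
have r01 : 0 <= r < 1.
  rewrite powR_ge0/= /r /powR gt_eqF// expR_lt1 nmulr_rlt0 ?subr_lt0//.
  by rewrite ln_gt0// ltr1n.
have B0 : 0 <= B by rewrite !mulr_ge0// powR_ge0.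
have IF k : (\int[P]_w F k w <= (B * r ^+ k)%:E)%E.
  rewrite /F; under eq_integral do rewrite EFinM.
  rewrite ge0_integralZl_EFin//; last first.
    by apply/measurable_EFinP; exact: measurable_gt_natr.
  rewrite integral_gt_natr -EFinM lee_fin.
  have tk : t0 <= 2 ^+ k * t0.
    by rewrite ler_peMl ?(ltW t00)// exprn_ege1// ler1n.
  apply: (le_trans (ler_wpM2l (c0 k) (HC _ tk))).
  rewrite /c /B /r exprSr mulrAC.
  have k0 : 0 <= 2 ^+ k :> R by rewrite exprn_ge0.
  rewrite -[2 ^+ k * t0 * 2]mulrA (mulrC t0 2) !powRM ?mulr_ge0 ?(ltW t00)//.
  rewrite -[X in X `^ q]powR_mulrn// -[X in X `^ (- a)]powR_mulrn//.
  rewrite -!powRrM -[X in _ <= _ * X]powR_mulrn ?powR_ge0// -powRrM.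
  rewrite (_ : (q - a) * k%:R = k%:R * q + k%:R * - a); last ring.
  rewrite powRD; last by rewrite pnatr_eq0 implybT.
  by rewrite le_eqVlt; apply/orP; left; apply/eqP; ring.
apply: (@le_lt_trans _ _ (\int[P]_w ((t0 `^ q)%:E + \sum_(0 <= k <oo) F k w))%E).
  apply: ge0_le_integral => //.
  - by move=> w _; rewrite lee_fin powR_ge0.
  - by apply/measurable_EFinP; exact: measurable_powR_RV.
  - apply: emeasurable_funD => //; apply: ge0_emeasurable_sum => //.
  move=> w _; have [Yt|tY] := leP (Y w) t0.
    rewrite -[leLHS]adde0; apply: leeD.
      by rewrite lee_fin; apply: ge0_ler_powR; rewrite ?nnegrE ?(ltW q0) ?(ltW t00).
    by apply: nneseries_ge0 => n _ _; exact: F0.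
  have [k /andP[k1 k2]] := dyadic_block t00 tY.
  rewrite -[leLHS]add0e; apply: leeD; first by rewrite lee_fin powR_ge0.
  apply: (@le_trans _ _ (F k w)).
    rewrite /F k1 mulr1 lee_fin ge0_ler_powR// ?nnegrE ?(ltW q0)//.
    by rewrite mulr_ge0 ?(ltW t00)// exprn_ge0.
  apply: le_trans (nneseries_lim_ge k.+1 _); last by move=> *; exact: F0.
  rewrite big_nat_recr//= leeDr// sume_ge0//.
rewrite ge0_integralD//; last 3 first.
- by move=> w _; rewrite lee_fin powR_ge0.
- by move=> w _; apply: nneseries_ge0 => n _ _; exact: F0.
- exact: ge0_emeasurable_sum.
rewrite integral_cst_probability integral_nneseries//.
apply: lte_add_pinfty; first exact: ltry.
apply: (@le_lt_trans _ _ (B / (1 - r))%:E); last exact: ltry.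
apply: lime_le.
  by apply: is_cvg_ereal_nneg_natsum => n _; apply: integral_ge0.
near=> N.
apply: (le_trans (lee_sum _ (fun k _ => IF k))).
by rewrite sumEFin lee_fin; exact: geometric_sum_le.
Unshelve. all: by end_near. Qed.

End moments.

(** * The stationary-excess distribution of the service times *)
Section density.
Context {d : measure_display} {T : measurableType d} {R : realType}.
Variable P : probability T R.
Local Notation leb := (@lebesgue_measure R).

Lemma tail_nonincreasing (Y : {RV P >-> R}) (s t : R) : s <= t -> tail Y t <= tail Y s.
Proof.
move=> st; apply: fine_le; rewrite ?fin_num_measure//.
exact: ccdf_nonincreasing.
Qed.

Lemma measurable_tail (Y : {RV P >-> R}) : measurable_fun setT (tail Y).
Proof. by apply: nonincreasing_measurable => // s t; exact: tail_nonincreasing. Qed.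

Lemma integral_id_itv (v : R) : 0 <= v ->
  (\int[leb]_(s in `[0%R, v]) s%:E = (v ^+ 2 / 2)%:E)%E.
Proof.
rewrite le_eqVlt => /predU1P[<-|v0].
  by rewrite set_itv1 integral_set1 expr0n/= mul0r.
rewrite (@continuous_FTC2 _ (fun s => s) (fun s => s ^+ 2 / 2) 0 v)//.
- by rewrite expr0n/= mul0r sube0.
- by apply: continuous_subspaceT => s; exact: cvg_id.
- split.
  + by move=> z _; exact: ex_derive.
  + apply/cvg_at_right_filter; apply: cvgM; last exact: cvg_cst.
    by rewrite expr2; apply: cvgM; exact: cvg_id.
  + apply/cvg_at_left_filter; apply: cvgM; last exact: cvg_cst.
    by rewrite expr2; apply: cvgM; exact: cvg_id.
- move=> z _; rewrite derive1E derive_val !scaler0 add0r /GRing.scale/= !mulr1; by field.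
Qed.

Section equilibrium.
Variables (V X : {RV P >-> R}) (m : R).
Hypothesis (V0 : forall w, 0 <= V w) (m0 : 0 < m).
Hypothesis (hX : has_density_pos X (fun t => tail V t / m)).
Local Notation G := (tail V).
Local Notation H := (tail X).

Let mg : measurable_fun setT (fun t => G t / m).
Proof. by apply: measurable_funM => //; exact: measurable_tail. Qed.

Let g0 t : 0 <= G t / m.
Proof. by rewrite divr_ge0 ?tail_ge0// ltW. Qed.

Let tail_split (x y : R) : x <= y ->
  ((H x)%:E = distribution P X `]x, y] + (H y)%:E)%E.
Proof.
move=> xy.
rewrite /tail !fineK ?fin_num_measure//; last first.
rewrite /ccdf -measureU//.
  congr (distribution P X _); apply/seteqP; split => z /=; rewrite !in_itv/= !andbT.
    by move=> xz; have [zy|yz] := leP z y; [left; rewrite xz|right].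
  by move=> [/andP[]//|]; exact: le_lt_trans.
apply/seteqP; split => z //=; rewrite !in_itv/= andbT => -[/andP[_ zy]].
by rewrite ltNge zy.
Qed.

Let tail_incr (x y : R) : 0 <= x -> x <= y ->
  (distribution P X `]x, y] = \int[leb]_(t in `]x, y]) (G t / m)%:E)%E.
Proof.
move=> x0 xy; rewrite hX//; congr integral.
apply/seteqP; split => z /=; rewrite !in_itv/= ?andbT; first by case.
move=> /andP[xz zy]; split => //.
  by rewrite xz.
exact: le_lt_trans xz.
Qed.

Let leb_itv (x y : R) : x <= y -> leb `]x, y] = (y - x)%:E.
Proof.
move=> xy; rewrite lebesgue_measure_itv/= lte_fin.
have [//|yx] := ltP x y; have -> : x = y by apply/eqP; rewrite eq_le xy.
by rewrite subrr.
Qed.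

Lemma equilibrium_tail_increment_le (x y : R) : 0 <= x -> x <= y ->
  H x - H y <= (y - x) * (G x / m).
Proof.
move=> x0 xy; rewrite -lee_fin EFinB (tail_split xy) addeK// tail_incr//.
rewrite mulrC EFinM -leb_itv// -integral_cst//.
apply: ge0_le_integral => //.
- by move=> t _; rewrite lee_fin.
- exact/measurable_EFinP/measurable_funTS.
- move=> t /=; rewrite in_itv/= => /andP[xt _].
  by rewrite lee_fin ler_pM2r ?invr_gt0// tail_nonincreasing// ltW.
Qed.

Lemma equilibrium_tail_increment_ge (x y : R) : 0 <= x -> x <= y ->
  (y - x) * (G y / m) <= H x - H y.
Proof.
move=> x0 xy; rewrite -lee_fin EFinB (tail_split xy) addeK// tail_incr//.
rewrite mulrC EFinM -leb_itv// -integral_cst//.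
apply: ge0_le_integral => //.
- by move=> t _; rewrite lee_fin.
- exact/measurable_EFinP/measurable_funTS.
- move=> t /=; rewrite in_itv/= => /andP[_ ty].
  by rewrite lee_fin ler_pM2r ?invr_gt0// tail_nonincreasing.
Qed.

(** Tonelli twice: E[Y] is the integral of s G s / m over s > 0, and s G s is the
    integral over the sample space of s 1{s < V}.  Y is any nonnegative variable
    with the same tail as X on the half-line, because X itself is nonnegative
    only almost surely. *)
Lemma equilibrium_mean (Y : {RV P >-> R}) : (forall w, 0 <= Y w) ->
  (forall r, 0 <= r -> ccdf Y r = ccdf X r) ->
  ('E_P[Y] = (m^-1 / 2)%:E * \int[P]_w (V w ^+ 2)%:E)%E.
Proof.
move=> Y0 YX.
pose f (z : R * R) : \bar R := ((0 <= z.1)%R%:R * (z.1 < z.2)%R%:R * (G z.2 / m))%:E.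
have f0 z : (0 <= f z)%E by rewrite lee_fin; apply: mulr_ge0 => //; apply: mulr_ge0.
have mtrue (S : Type) (dS : measure_display) (U : measurableType dS) (b : U -> bool) :
    measurable_fun setT b -> measurable_fun setT (fun z => (b z)%:R : R).
  move=> mb; rewrite (_ : (fun z => _) = \1_[set z | b z]).
    apply: measurable_indic; rewrite (_ : [set z | b z] = b @^-1` [set true]).
      by rewrite -[X in measurable X]setTI; exact: mb.
    by [].
  by apply/funext => z; rewrite indicE/= mem_setE.
have mf : measurable_fun setT f.
  apply/measurable_EFinP; apply: measurable_funM.
    apply: measurable_funM; apply: (mtrue R).
      by apply: measurable_fun_ler => //; exact: measurable_fst.
    by apply: measurable_fun_ltr; [exact: measurable_fst|exact: measurable_snd].
  by apply: (measurableT_comp mg); exact: measurable_snd.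
transitivity (\int[leb]_r \int[leb]_s f (r, s))%E.
  rewrite ge0_expectation_ccdf// integral_mkcond; apply: eq_integral => r _.
  rewrite patchE; have [r0|r0] := leP 0 r; last first.
    rewrite memNset; last by rewrite /= in_itv/= leNgt r0.
    by apply/esym/integral0_eq => s _; rewrite /f/= leNgt r0 !mul0r.
  rewrite mem_set; last by rewrite /= in_itv/= r0.
  rewrite YX// /ccdf hX// integral_mkcond; apply: eq_integral => s _.
  rewrite patchE /f/= r0 mul1r; have [rs|sr] := ltP r s.
    by rewrite mem_set ?mul1r//=; split; rewrite in_itv/= andbT// (le_lt_trans r0).
  rewrite memNset ?mul0r//= => -[]; rewrite in_itv/= andbT => rs.
  by rewrite ltNge sr in rs.
rewrite (@fubini_tonelli _ _ _ _ _ leb leb f)//.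
pose k (z : R * T) : \bar R := (m^-1 * ((0 < z.1)%R%:R * (z.1 < V z.2)%R%:R * z.1))%:E.
have k0 z : (0 <= k z)%E.
  rewrite lee_fin mulr_ge0 ?invr_ge0 ?(ltW m0)//.
  have [z0|] := ltP 0 z.1; last by rewrite !mul0r.
  by rewrite !mulr_ge0// ltW.
have mk : measurable_fun setT k.
  apply/measurable_EFinP; apply: measurable_funM => //; apply: measurable_funM; last exact: measurable_fst.
  apply: measurable_funM; apply: (mtrue R).
    by apply: measurable_fun_ltr => //; exact: measurable_fst.
  apply: measurable_fun_ltr; first exact: measurable_fst.
  by apply: measurableT_comp => //; exact: measurable_snd.
transitivity (\int[leb]_s \int[P]_w k (s, w))%E.
  apply: eq_integral => s _; rewrite /f /k/=.
  have [s0|s0] := ltP 0 s; last first.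
    rewrite !integral0_eq//= => [w _|r _]; first by rewrite !mul0r mulr0.
    have [r0|] := leP 0 r; last by rewrite !mul0r.
    by rewrite ltNge (le_trans s0 r0)/= mulr0 mul0r.
  transitivity (\int[leb]_(r in `[0%R, s[) (G s / m)%:E)%E.
    rewrite [RHS]integral_mkcond; apply: eq_integral => r _.
    rewrite patchE; have [rs|rs] := boolP (0 <= r < s).
      by rewrite mem_set/=; [case/andP: rs => -> ->; rewrite !mul1r|rewrite in_itv].
    rewrite memNset/=; last by rewrite in_itv/=; exact/negP.
    by move: rs; rewrite negb_and => /orP[/negbTE->|/negbTE->]; rewrite ?mulr0 !mul0r.
  rewrite integral_cst//=.
  rewrite lebesgue_measure_itv/= lte_fin s0 oppr0 adde0.
  rewrite (eq_integral (fun w => (s / m)%:E * ((s < V w)%R%:R)%:E)%E); last first.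
    by move=> w _; rewrite mul1r -EFinM; congr EFin; ring.
  rewrite ge0_integralZl_EFin//; last 2 first.
  - by apply/measurable_EFinP; exact: measurable_gt_natr.
  - by rewrite mulr_ge0 ?invr_ge0 ?ltW.
  by rewrite integral_gt_natr -!EFinM; congr EFin; ring.
rewrite (@fubini_tonelli _ _ _ _ _ leb P k)//.
rewrite -ge0_integralZl_EFin//; last 3 first.
- by move=> w _; rewrite lee_fin sqr_ge0.
- by apply/measurable_EFinP; exact: measurable_funX.
- by rewrite divr_ge0// invr_ge0 ltW.
apply: eq_integral => w _.
transitivity ((m^-1)%:E * \int[leb]_(s in `[0%R, V w]) s%:E)%E; last first.
  by rewrite integral_id_itv// -!EFinM; congr EFin; ring.
transitivity (\int[leb]_(s in `]0%R, V w[) ((m^-1)%:E * s%:E))%E.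
  rewrite [RHS]integral_mkcond; apply: eq_integral => s _.
  rewrite patchE /k/=; have [sv|sv] := boolP (0 < s < V w).
    by rewrite mem_set/=; [case/andP: sv => -> ->; rewrite !mul1r EFinM|rewrite in_itv].
  rewrite memNset/=; last by rewrite in_itv/=; exact/negP.
  by move: sv; rewrite negb_and => /orP[/negbTE->|/negbTE->]; rewrite ?mulr0 !mul0r mulr0.
rewrite ge0_integralZl_EFin ?invr_ge0 ?(ltW m0)//; last first.
  by move=> s /=; rewrite in_itv/= lee_fin => /andP[/ltW].
congr (_ * _)%E; apply/esym/integral_itv_bndoo; exact/measurable_EFinP.
Qed.

End equilibrium.
End density.

(** * Regularly varying tails *)
Section regular_variation.
Context {R : realType}.

Lemma near_pinfty_ex (Q : R -> Prop) : (\forall x \near +oo, Q x) ->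
  exists2 x0, 0 < x0 & forall x, x0 <= x -> Q x.
Proof.
move=> [M [Mreal HM]]; exists (Num.max M 0 + 1).
  by rewrite ltr_pwDr// le_max lexx orbT.
move=> x xM; apply: HM; apply: lt_le_trans xM.
by rewrite ltr_pwDr// le_max lexx.
Qed.

Lemma powR1D (x a : R) : 0 < x -> x `^ (1 + a) = x * x `^ a.
Proof.
move=> x0; rewrite powRD; first by rewrite powRr1// ltW.
by rewrite (gt_eqF x0) implybT.
Qed.

Lemma cvg_mulr_pinfty (k : R) : 0 < k -> k * x @[x --> +oo] --> +oo.
Proof. by move=> k0; apply: gt0_cvgMry => //; exact: cvg_id. Qed.

(** Replaces the uniform convergence theorem for slowly varying functions:
    combined with the monotonicity of G, which controls each dyadic block, it
    yields power bounds from the ratio G (2 t) / G t alone. *)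
Lemma dyadic_bounded (phi : R -> R) (x0 C : R) : 0 < x0 ->
  (forall t, x0 <= t -> phi (2 * t) <= phi t) ->
  (forall t, x0 <= t -> t <= 2 * x0 -> phi t <= C) ->
  forall t, x0 <= t -> phi t <= C.
Proof.
move=> x00 step base t x0t.
have key (k : nat) : forall t, x0 <= t -> t <= 2 ^+ k.+1 * x0 -> phi t <= C.
  elim: k => [|k IH] {x0t}t x0t; first by rewrite expr1; exact: base.
  move=> tk; have [t2|t2] := leP t (2 * x0); first exact: base.
  have -> : t = 2 * (t / 2) by field.
  apply: (le_trans (step _ _)); first by lra.
  apply: IH; first by lra.
  by rewrite ler_pdivrMr// mulrAC -exprSr.
have [<-|tx0] := eqVneq x0 t; first by apply: base => //; lra.
have x0t' : x0 < t by rewrite lt_neqAle tx0.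
have [k /andP[_ tk]] := dyadic_block x00 x0t'.
exact: key tk.
Qed.

Variables (G L : R -> R) (alpha : R).
Hypothesis G_noninc : forall s t, s <= t -> G t <= G s.
Hypothesis G_ge0 : forall t, 0 <= G t.
Hypothesis (hL : slowly_varying L).
Hypothesis (hG : asymp_equiv G (fun x => L x * x `^ (- alpha))).

Lemma slowly_varying_gt0 : \forall x \near +oo, 0 < L x.
Proof.
have [A [_ L0 _]] := hL; near=> x; apply: L0; near: x.
apply: nbhs_pinfty_ge; exact: num_real.
Unshelve. all: by end_near. Qed.

Lemma regvar_gt0 t : 0 < G t.
Proof.
have h : \forall x \near +oo, 0 < G x.
  have h1 : \forall x \near +oo, 0 < G x / (L x * x `^ (- alpha)).
    have := hG; rewrite /asymp_equiv => /cvgr_gt; apply; exact: ltr01.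
  near=> x; have x0 : 0 < x by near: x; apply: nbhs_pinfty_gt; exact: num_real.
  have Lx : 0 < L x by near: x; exact: slowly_varying_gt0.
  have : 0 < G x / (L x * x `^ (- alpha)) by near: x.
  by rewrite pmulr_lgt0// invr_gt0 mulr_gt0// powR_gt0.
have [x0 _ Hx0] := near_pinfty_ex h.
have [tx|tx] := leP x0 t; first exact: Hx0.
by apply: (lt_le_trans (Hx0 _ (lexx _))); exact/G_noninc/ltW.
Unshelve. all: by end_near. Qed.

(** Follows from the slow variation of L for the ratio 2 only. *)
Lemma regvar_doubling_cvg : G (2 * x) / G x @[x --> +oo] --> 2 `^ (- alpha).
Proof.
have c2 : (2 * x : R) @[x --> +oo] --> +oo by exact: cvg_mulr_pinfty.
pose h x := L x * x `^ (- alpha).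
have H2 : G (2 * x) / h (2 * x) @[x --> +oo] --> (1 : R).
  exact: (cvg_comp _ _ c2 hG).
have H1 : (G x / h x)^-1 @[x --> +oo] --> (1 : R).
  by rewrite -[X in _ --> X]invr1; apply: cvgV => //; exact: oner_neq0.
have HL : L (2 * x) / L x @[x --> +oo] --> (1 : R).
  by case: hL => A [_ _]; apply.
have h0 : (G (2 * x) / h (2 * x)) * (L (2 * x) / L x) * (2 `^ (- alpha) * (G x / h x)^-1)
    @[x --> +oo] --> 1 * 1 * (2 `^ (- alpha) * 1 : R).
  by apply: cvgM; [exact: cvgM|apply: cvgM => //; exact: cvg_cst].
rewrite !mul1r mulr1 in h0; apply: cvg_trans h0; apply: near_eq_cvg; near=> x.
have x0 : 0 < x by near: x; apply: nbhs_pinfty_gt; exact: num_real.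
have Lx : 0 < L x by near: x; exact: slowly_varying_gt0.
have L2x : 0 < L (2 * x).
  by near: x; exact: (c2 _ slowly_varying_gt0).
have xa : 0 < x `^ (- alpha) by exact: powR_gt0.
have ta : 0 < 2 `^ (- alpha) :> R by exact: powR_gt0.
rewrite /h powRM// ?(ltW x0)//; field.
by rewrite !gt_eqF// regvar_gt0.
Unshelve. all: by end_near. Qed.

Lemma regvar_doubling (delta : R) : 0 < delta ->
  exists2 x0, 0 < x0 & forall x, x0 <= x ->
    2 `^ (- (alpha + delta)) * G x <= G (2 * x) <= 2 `^ (- (alpha - delta)) * G x.
Proof.
move=> d0; apply: near_pinfty_ex.
have lt1 : 2 `^ (- (alpha + delta)) < 2 `^ (- alpha) :> R.
  rewrite /powR !gt_eqF// ltr_expR ltr_pM2r ?ln_gt0 ?ltr1n//; lra.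
have lt2 : 2 `^ (- alpha) < 2 `^ (- (alpha - delta)) :> R.
  rewrite /powR !gt_eqF// ltr_expR ltr_pM2r ?ln_gt0 ?ltr1n//; lra.
near=> x; have Gx := regvar_gt0 x.
rewrite -(ler_pdivlMr _ _ Gx) -(ler_pdivrMr _ _ Gx).
apply/andP; split; apply: ltW; near: x.
- by apply: (cvgr_gt _ regvar_doubling_cvg).
- by apply: (cvgr_lt _ regvar_doubling_cvg).
Unshelve. all: by end_near. Qed.

Lemma regvar_power_upper (delta : R) : 0 < delta ->
  exists C x0, [/\ 0 < C, 0 < x0 &
    forall x, x0 <= x -> G x <= C * x `^ (- (alpha - delta))].
Proof.
move=> d0; have [x0 x00 H] := regvar_doubling d0.
pose a := alpha - delta; pose phi t := G t * t `^ a.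
pose C := G x0 * Num.max (x0 `^ a) ((2 * x0) `^ a).
have C0 : 0 < C by rewrite mulr_gt0 ?regvar_gt0// lt_max powR_gt0.
exists C, x0; split => // x x0x.
have x_gt0 : 0 < x by exact: lt_le_trans x0x.
rewrite powRN ler_pdivlMr ?powR_gt0// -/a -/(phi x).
apply: (@dyadic_bounded phi x0) => // t x0t.
- have t0 : 0 < t by exact: lt_le_trans x0t.
  have /andP[_ h] := H t x0t.
  rewrite /phi powRM ?(ltW t0)// mulrA ler_pM2r ?powR_gt0//.
  by rewrite -ler_pdivlMr ?powR_gt0// -powRN [X in _ <= X]mulrC.
- move=> t2; have t0 : 0 < t by exact: lt_le_trans x0t.
  rewrite /phi /C; apply: ler_pM; rewrite ?powR_ge0 ?G_noninc// le_max.
  have [a0|a0] := leP 0 a; apply/orP; [right|left].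
    by apply: ge0_ler_powR; rewrite ?nnegrE ?mulr_ge0 ?(ltW t0) ?(ltW x00).
  have aE : a = - (- a) by rewrite opprK.
  rewrite aE; move: (- a) (oppr_ge0 a) => b; rewrite (ltW a0) => b0.
  rewrite !powRN lef_pV2 ?posrE ?powR_gt0//.
  by apply: ge0_ler_powR; rewrite ?nnegrE ?b0 ?(ltW t0) ?(ltW x00).
Qed.

Lemma regvar_power_lower (delta : R) : 0 < delta ->
  exists c x0, [/\ 0 < c, 0 < x0 &
    forall x, x0 <= x -> c * x `^ (- (alpha + delta)) <= G x].
Proof.
move=> d0; have [x0 x00 H] := regvar_doubling d0.
pose a := alpha + delta; pose phi t := - (G t * t `^ a).
pose c := G (2 * x0) * Num.min (x0 `^ a) ((2 * x0) `^ a).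
have c0 : 0 < c by rewrite mulr_gt0 ?regvar_gt0// lt_min !powR_gt0// mulr_gt0.
exists c, x0; split => // x x0x.
have x_gt0 : 0 < x by exact: lt_le_trans x0x.
rewrite powRN ler_pdivrMr ?powR_gt0// -/a -lerN2 -/(phi x).
apply: (@dyadic_bounded phi x0) => // t x0t.
- have t0 : 0 < t by exact: lt_le_trans x0t.
  have /andP[h _] := H t x0t.
  rewrite /phi lerN2 powRM ?(ltW t0)// mulrA ler_pM2r ?powR_gt0//.
  by rewrite -ler_pdivrMr ?powR_gt0// -powRN [X in X <= _]mulrC.
- move=> t2; have t0 : 0 < t by exact: lt_le_trans x0t.
  have x020 : 0 < 2 * x0 by rewrite mulr_gt0.
  rewrite /phi /c lerN2; apply: ler_pM; rewrite ?G_noninc//.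
    by rewrite le_min !powR_ge0.
  rewrite ge_min.
  have [a0|a0] := leP 0 a; apply/orP; [left|right].
    by apply: ge0_ler_powR; rewrite ?nnegrE ?(ltW t0) ?(ltW x00).
  have aE : a = - (- a) by rewrite opprK.
  rewrite aE; move: (- a) (oppr_ge0 a) => b; rewrite (ltW a0) => b0.
  rewrite !powRN lef_pV2 ?posrE ?powR_gt0//.
  by apply: ge0_ler_powR; rewrite ?nnegrE ?b0 ?(ltW t0) ?(ltW x020).
Qed.

(** The bounds on the increments of H are all that is used of H' = - G / m. *)
Variables (H : R -> R) (m : R).
Hypothesis (m0 : 0 < m) (alpha2 : 2 < alpha).
Hypothesis H_ge0 : forall t, 0 <= H t.
Hypothesis H_cvg0 : H x @[x --> +oo] --> (0 : R).
Hypothesis H_noninc : forall s t, s <= t -> H t <= H s.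
Hypothesis H_incr_le : forall x y, 0 <= x -> x <= y -> H x - H y <= (y - x) * (G x / m).
Hypothesis H_incr_ge : forall x y, 0 <= x -> x <= y -> (y - x) * (G y / m) <= H x - H y.

(** A one-sided substitute for Karamata's theorem: since 2 t G (2 t) <= r t G t
    with r < 1, the function H t - C t G t increases along t, 2 t, 4 t, ... when
    C is large, while it is at most H, which tends to 0; hence it is never
    positive. *)
Lemma integrated_tail_upper : exists C x0, [/\ 0 < C, 0 < x0 &
  forall x, x0 <= x -> H x <= C * (x * G x)].
Proof.
have a2 := alpha2; have mgt0 := m0.
have d0 : 0 < (alpha - 1) / 2 by lra.
have [x0 x00 D] := regvar_doubling d0.
pose r : R := 2 * 2 `^ (- (alpha - (alpha - 1) / 2)).
have r1 : r < 1.
  rewrite /r -[X in X * _]powRr1// -powRD ?pnatr_eq0 ?implybT//.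
  rewrite /powR gt_eqF// expR_lt1 nmulr_rlt0 ?ln_gt0 ?ltr1n//; lra.
have r0 : 0 < r by rewrite mulr_gt0// powR_gt0.
pose C := (m * (1 - r))^-1.
have C0 : 0 < C by rewrite invr_gt0 mulr_gt0// subr_gt0.
exists C, x0; split => // x x0x.
pose Phi t := H t - C * (t * G t).
have step t : x0 <= t -> Phi t <= Phi (2 * t).
  move=> x0t; have t0 : 0 < t by exact: lt_le_trans x0t.
  have /andP[_ h] := D t x0t.
  have h1 : H t - H (2 * t) <= (2 * t - t) * (G t / m).
    by apply: H_incr_le; [exact: ltW|lra].
  have h2 : 2 * t * G (2 * t) <= r * (t * G t).
    rewrite /r; have := ler_wpM2l (ltW t0) h; lra.
  have h3 : C * (1 - r) = m^-1 by rewrite /C; field; rewrite (gt_eqF m0) gt_eqF// subr_gt0.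
  have h4 := ler_wpM2l (ltW C0) h2.
  have h5 : (2 * t - t) * (G t / m) = (t * G t) * (C * (1 - r)) by rewrite h3; ring.
  rewrite /Phi; nra.
have key n : Phi x <= H (2 ^+ n * x).
  have : Phi x <= Phi (2 ^+ n * x).
    elim: n => [|n IH]; first by rewrite expr0 mul1r.
    apply: (le_trans IH); rewrite exprS -mulrA; apply: step.
    apply: (le_trans x0x); rewrite ler_peMl ?exprn_ege1 ?ler1n//.
    by apply: ltW; exact: lt_le_trans x0x.
  move/le_trans; apply; rewrite /Phi lerBlDr lerDl.
  have x_gt0 : 0 < x by exact: lt_le_trans x0x.
  by rewrite !mulr_ge0 ?(ltW C0) ?G_ge0 ?exprn_ge0 ?(ltW x_gt0).
rewrite -subr_le0 -/(Phi x).
have x_gt0 : 0 < x by exact: lt_le_trans x0x.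
apply/ler_addgt0Pr => e e0; rewrite add0r.
have [y0 y00 Hy] : exists2 y0, 0 < y0 & forall y, y0 <= y -> H y <= e.
  by apply: near_pinfty_ex; apply: (cvgr_le _ H_cvg0).
pose n := (Num.truncn (y0 / x)).+1.
apply: (le_trans (key n)); apply: Hy.
rewrite -ler_pdivrMr//; apply: (le_trans (ltW (truncnS_gt _))).
by rewrite -natrX ler_nat ltnW// ltn_expl.
Qed.

(** Bound H x from below by the increment over [x, 2 x]. *)
Lemma integrated_tail_lower x : 0 <= x -> x * G (2 * x) / m <= H x.
Proof.
move=> x0; have h : (2 * x - x) * (G (2 * x) / m) <= H x - H (2 * x).
  by apply: H_incr_ge => //; lra.
have := H_ge0 (2 * x).
have -> : x * G (2 * x) / m = (2 * x - x) * (G (2 * x) / m) by ring.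
lra.
Qed.

Lemma regvar_half : exists K x0, [/\ 0 < K, 0 < x0 &
  forall x, x0 <= x -> G x <= K * G (2 * x)].
Proof.
have [x0 x00 D] := regvar_doubling ltr01.
exists (2 `^ (alpha + 1)), x0; split => //.
move=> x x0x; have /andP[h _] := D x x0x.
by rewrite -ler_pdivrMl ?powR_gt0// -powRN.
Qed.

Lemma integrated_tail_power_upper (delta : R) : 0 < delta ->
  exists C x0, [/\ 0 < C, 0 < x0 &
    forall x, x0 <= x -> H x <= C * x `^ (- (alpha - 1 - delta))].
Proof.
move=> d0.
have [C1 [x1 [C10 x10 H1]]] := integrated_tail_upper.
have [C2 [x2 [C20 x20 H2]]] := regvar_power_upper d0.
exists (C1 * C2), (Num.max x1 x2); split; rewrite ?mulr_gt0 ?lt_max ?x10// => x.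
rewrite ge_max => /andP[x1x x2x].
have x0 : 0 < x by exact: lt_le_trans x1x.
apply: (le_trans (H1 _ x1x)); rewrite -mulrA ler_pM2l//.
have -> : - (alpha - 1 - delta) = 1 + - (alpha - delta) by ring.
rewrite powR1D// mulrCA ler_pM2l//.
exact: H2.
Qed.

Lemma integrated_tail_power_lower (delta : R) : 0 < delta ->
  exists c x0, [/\ 0 < c, 0 < x0 &
    forall x, x0 <= x -> c * x `^ (- (alpha - 1 + delta)) <= H x].
Proof.
move=> d0.
have [c [x2 [c0 x20 H2]]] := regvar_power_lower d0.
exists (c * 2 `^ (- (alpha + delta)) / m), x2; split => //.
  by rewrite divr_gt0// mulr_gt0// powR_gt0.
move=> x x2x; have x0 : 0 < x by exact: lt_le_trans x2x.
apply: le_trans (integrated_tail_lower (ltW x0)).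
have : c * (2 * x) `^ (- (alpha + delta)) <= G (2 * x) by apply: H2; lra.
rewrite powRM ?(ltW x0)// => h.
have -> : - (alpha - 1 + delta) = 1 + - (alpha + delta) by ring.
rewrite powR1D//.
rewrite mulrAC ler_pM2r ?invr_gt0//.
have := ler_wpM2l (ltW x0) h; lra.
Qed.

Lemma regvar_comparable : exists x0, 0 < x0 /\ forall x, x0 <= x ->
  [/\ 0 < L x, L x * x `^ (- alpha) / 2 <= G x & G x <= 2 * (L x * x `^ (- alpha))].
Proof.
suff /near_pinfty_ex[x0 x00 h] : \forall x \near +oo,
    [/\ 0 < L x, L x * x `^ (- alpha) / 2 <= G x & G x <= 2 * (L x * x `^ (- alpha))].
  by exists x0.
near=> x; have x0 : 0 < x by near: x; apply: nbhs_pinfty_gt; exact: num_real.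
have Lx : 0 < L x by near: x; exact: slowly_varying_gt0.
have h0 : 0 < L x * x `^ (- alpha) by rewrite mulr_gt0// powR_gt0.
have h1 : G x / (L x * x `^ (- alpha)) < 2.
  by near: x; apply: (cvgr_lt _ hG); rewrite ltr1n.
have h2 : 2^-1 < G x / (L x * x `^ (- alpha)).
  by near: x; apply: (cvgr_gt _ hG); rewrite invf_lt1// ltr1n.
split => //.
  by move: h2; rewrite ltr_pdivlMr// => /ltW; rewrite mulrC.
by move: h1; rewrite ltr_pdivrMr// => /ltW.
Unshelve. all: by end_near. Qed.

Lemma integrated_tail_comparable : exists c C x0, [/\ 0 < c, 0 < C, 0 < x0 &
  forall x, x0 <= x ->
    c * (L x * x `^ (1 - alpha)) <= H x <= C * (L x * x `^ (1 - alpha))].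
Proof.
have [C1 [x1 [C10 x10 H1]]] := integrated_tail_upper.
have [K [x2 [K0 x20 H2]]] := regvar_half.
have [x3 [x30 H3]] := regvar_comparable.
exists (2 * K * m)^-1, (2 * C1), (x1 + x2 + x3); split.
- by rewrite invr_gt0 !mulr_gt0.
- by rewrite mulr_gt0.
- lra.
move=> x xx; have [x1x x2x x3x] : [/\ x1 <= x, x2 <= x & x3 <= x] by split; lra.
have x0 : 0 < x by exact: lt_le_trans x1x.
have [Lx l u] := H3 x x3x.
rewrite powR1D//.
set t := L x * x `^ (- alpha) in l u; have -> : L x * (x * x `^ (- alpha)) = x * t.
  by rewrite /t mulrCA.
apply/andP; split.
  apply: le_trans (integrated_tail_lower (ltW x0)).
  have h := H2 x x2x.
  have -> : (2 * K * m)^-1 * (x * t) = x * (K^-1 * (t / 2)) / m.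
    by field; rewrite (gt_eqF m0) (gt_eqF K0).
  rewrite ler_pM2r ?invr_gt0// ler_pM2l// ler_pdivrMl//; lra.
apply: (le_trans (H1 x x1x)).
have := ler_wpM2l (ltW x0) u; have := ler_wpM2l (ltW C10) (ler_wpM2l (ltW x0) u); lra.
Qed.

Lemma integrated_tail_doubling : exists K x0, [/\ 0 < K, 0 < x0 &
  forall x, x0 <= x -> H x <= K * H (2 * x)].
Proof.
have [K [x2 [K0 x20 H2]]] := regvar_half.
exists (1 + K ^+ 2), x2; split => //; first by rewrite ltr_pwDl// sqr_ge0.
move=> x x2x; have x0 : 0 < x by exact: lt_le_trans x2x.
have h1 : H x - H (2 * x) <= (2 * x - x) * (G x / m) by apply: H_incr_le; lra.
have h2 : 2 * x * G (2 * (2 * x)) / m <= H (2 * x) by apply: integrated_tail_lower; lra.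
have h3 := H2 x x2x.
have h4 : G (2 * x) <= K * G (2 * (2 * x)) by apply: H2; lra.
have h5 : G x <= K ^+ 2 * G (2 * (2 * x)).
  by apply: (le_trans h3); rewrite expr2 -mulrA ler_pM2l.
have h6 : (2 * x - x) * (G x / m) <= K ^+ 2 * (x * G (2 * (2 * x)) / m).
  have -> : (2 * x - x) * (G x / m) = x / m * G x by ring.
  have -> : K ^+ 2 * (x * G (2 * (2 * x)) / m) = x / m * (K ^+ 2 * G (2 * (2 * x))) by ring.
  by rewrite ler_pM2l// divr_gt0.
have h7 : x * G (2 * (2 * x)) / m <= H (2 * x).
  apply: le_trans h2.
  by rewrite ler_pM2r ?invr_gt0// ler_wpM2r ?G_ge0//; lra.
have := ler_wpM2l (sqr_ge0 K) h7; lra.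
Qed.

Lemma integrated_tail_scaling (lam : R) : 0 < lam -> exists K x0, [/\ 0 < K, 0 < x0 &
  forall x, x0 <= x -> H (lam * x) <= K * H x].
Proof.
move=> lam0.
have [K [x2 [K0 x20 H2]]] := integrated_tail_doubling.
pose n := (Num.truncn (lam^-1)).+1.
have hn : 1 <= lam * 2 ^+ n.
  rewrite -ler_pdivrMl// mulr1; apply: (le_trans (ltW (truncnS_gt _))).
  by rewrite -natrX ler_nat ltnW// ltn_expl.
exists (K ^+ n), (x2 / lam); split; rewrite ?exprn_gt0 ?divr_gt0// => x xx.
have xl : x2 <= lam * x by rewrite mulrC -ler_pdivrMr.
have x0 : 0 < x by apply: lt_le_trans xx; rewrite divr_gt0.
have key k : H (lam * x) <= K ^+ k * H (2 ^+ k * (lam * x)).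
  elim: k => [|k IH]; first by rewrite !expr0 !mul1r.
  apply: (le_trans IH); rewrite exprSr -mulrA ler_pM2l ?exprn_gt0//.
  rewrite exprS -mulrA; apply: H2; apply: (le_trans xl).
  by rewrite ler_peMl ?exprn_ege1 ?ler1n// mulr_ge0 ?ltW.
apply: (le_trans (key n)); rewrite ler_pM2l ?exprn_gt0//; apply: H_noninc.
by rewrite mulrA [_ * lam]mulrC ler_peMl// ltW.
Qed.

(** The increment over [(1 - delta) x, x] is at most delta x G (x / 2) / m, which
    is a multiple of delta H x because G (x / 2) and G (2 x) are comparable. *)
Lemma integrated_tail_continuity (e : R) : 0 < e ->
  exists delta x0, [/\ 0 < delta, delta < 1, 0 < x0 &
  forall x, x0 <= x -> H ((1 - delta) * x) <= (1 + e) * H x].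
Proof.
move=> e0.
have [K [x2 [K0 x20 H2]]] := regvar_half.
pose delta := Num.min 2^-1 (e / K ^+ 2).
have K20 : 0 < K ^+ 2 by rewrite exprn_gt0.
have d0 : 0 < delta by rewrite lt_min invr_gt0 ltr0n divr_gt0.
have d1 : delta <= 2^-1 by rewrite ge_min lexx.
have dK : delta * K ^+ 2 <= e by rewrite -ler_pdivlMr// ge_min lexx orbT.
exists delta, (2 * x2); split => //.
- lra.
- by rewrite mulr_gt0.
move=> x xx; have x0 : 0 < x by lra.
have l0 : 0 <= (1 - delta) * x by rewrite mulr_ge0 ?(ltW x0)//; lra.
have lx : (1 - delta) * x <= x by nra.
have h1 := H_incr_le l0 lx.
have h2 : G ((1 - delta) * x) <= K ^+ 2 * G (2 * x).
  apply: (@le_trans _ _ (G (x / 2))); first by apply: G_noninc; nra.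
  have a1 : G (x / 2) <= K * G (2 * (x / 2)) by apply: H2; lra.
  apply: (le_trans a1); rewrite expr2 -mulrA ler_pM2l//.
  have -> : 2 * (x / 2) = x by field.
  by apply: H2; lra.
have h3 := integrated_tail_lower (ltW x0).
have h4 : (x - (1 - delta) * x) * (G ((1 - delta) * x) / m) <= delta * K ^+ 2 * (x * G (2 * x) / m).
  have -> : (x - (1 - delta) * x) * (G ((1 - delta) * x) / m) = delta * x / m * G ((1 - delta) * x) by ring.
  have -> : delta * K ^+ 2 * (x * G (2 * x) / m) = delta * x / m * (K ^+ 2 * G (2 * x)) by ring.
  by rewrite ler_pM2l// divr_gt0// mulr_gt0.
have h5 : delta * K ^+ 2 * (x * G (2 * x) / m) <= e * H x.
  apply: ler_pM => //; first by rewrite mulr_ge0 ?(ltW d0) ?(ltW K20).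
  by rewrite divr_ge0 ?(ltW m0)// mulr_ge0 ?G_ge0 ?(ltW x0).
lra.
Qed.

End regular_variation.

(** * The logarithmic scale and the crossover *)
Section limits.
Context {R : realType}.

Lemma near_ge (A : R) : \forall l \near +oo, A <= l.
Proof. by apply: nbhs_pinfty_ge; exact: num_real. Qed.

Lemma near_expRN_le (s e : R) : 0 < s -> 0 < e ->
  \forall l \near +oo, expR (- (s * l)) <= e.
Proof.
move=> s0 e0; near=> l.
have h : e^-1 <= 1 + s * l.
  have : (e * s)^-1 <= l by near: l; exact: near_ge.
  rewrite invfM -ler_pdivlMr ?invr_gt0// invrK mulrC; lra.
rewrite expRN -[leRHS]invrK lef_pV2 ?posrE ?invr_gt0 ?expR_gt0//.
exact: le_trans (expR_ge1Dx _).
Unshelve. all: by end_near. Qed.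

Lemma near_linear_expRN_le (k s e : R) : 0 <= k -> 0 < s -> 0 < e ->
  \forall l \near +oo, k * l * expR (- (s * l)) <= e.
Proof.
move=> k0 s0 e0.
have s20 : 0 < s / 2 by rewrite divr_gt0.
have e'0 : 0 < e / (k + 1) * (s / 2) by rewrite mulr_gt0// divr_gt0// ltr_wpDl.
near=> l.
have l0 : 0 <= l by near: l; exact: near_ge.
have h1 : expR (- (s / 2 * l)) <= e / (k + 1) * (s / 2) by near: l; exact: near_expRN_le.
have h2 : (s / 2) * l * expR (- (s / 2 * l)) <= 1.
  rewrite expRN ler_pdivrMr ?expR_gt0// mul1r.
  by apply: le_trans (expR_ge1Dx _); rewrite lerDr.
have -> : - (s * l) = - (s / 2 * l) + - (s / 2 * l) by field.
rewrite expRD.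
have h3 : (s / 2) * l * expR (- (s / 2 * l)) * expR (- (s / 2 * l)) <= e / (k + 1) * (s / 2).
  by apply: le_trans h1; rewrite ler_piMl// expR_ge0.
have h4 : l * (expR (- (s / 2 * l)) * expR (- (s / 2 * l))) <= e / (k + 1).
  by rewrite -(ler_pM2r s20); apply: le_trans h3; rewrite le_eqVlt; apply/orP; left; apply/eqP; ring.
have h5 : 0 <= l * (expR (- (s / 2 * l)) * expR (- (s / 2 * l))).
  by rewrite !mulr_ge0// expR_ge0.
have h6 : (k + 1) * (e / (k + 1)) = e by field; lra.
rewrite -mulrA -h6; apply: ler_pM => //; lra.
Unshelve. all: by end_near. Qed.

Lemma ln_le_linear (k l : R) : 0 < k -> 0 < l -> ln l <= k * l - ln k.
Proof.
move=> k0 l0; have := ltW (ln_sublinear (mulr_gt0 k0 l0)).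
by rewrite lnM ?posrE//; lra.
Qed.

Lemma near_power_expRN_le (k q s e : R) : 0 < k -> 0 <= q -> 0 < s -> 0 < e ->
  \forall l \near +oo, (k * l) `^ q * expR (- (s * l)) <= e.
Proof.
move=> k0 q0 s0 e0.
pose a := s / (2 * (q + 1)).
have a0 : 0 < a by rewrite divr_gt0// mulr_gt0// ltr_wpDl.
pose Cq := expR (q * (ln k - ln a)).
have Cq0 : 0 < Cq by exact: expR_gt0.
near=> l.
have l0 : 0 < l.
  suff : 1 <= l by exact: lt_le_trans.
  by near: l; exact: near_ge.
have h1 : expR (- (s / 2 * l)) <= e / Cq.
  by near: l; apply: near_expRN_le; rewrite divr_gt0.
have kl : 0 < k * l by rewrite mulr_gt0.
rewrite /powR gt_eqF//.
have h2 : q * ln (k * l) <= q * (ln k - ln a) + s / 2 * l.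
  rewrite lnM ?posrE//.
  have h3 := ler_wpM2l q0 (ln_le_linear a0 l0).
  have h4 : q * (a * l) <= s / 2 * l.
    rewrite mulrA ler_pM2r//.
    have -> : s / 2 = (q + 1) * a by rewrite /a; field; lra.
    by rewrite ler_pM2r//; lra.
  lra.
rewrite -expRD.
apply: (@le_trans _ _ (Cq * expR (- (s / 2 * l)))).
  by rewrite /Cq -expRD ler_expR; lra.
by rewrite mulrC -ler_pdivlMr.
Unshelve. all: by end_near. Qed.

(** In terms of l = log (1 / eps) this is k (1 / eps) log (1 / eps), the order of
    magnitude of the boundary y; every limit is taken as l tends to infinity. *)
Definition scale (k l : R) := k * l * expR l.

Lemma scale_gt0 (k l : R) : 0 < k -> 0 < l -> 0 < scale k l.
Proof. by move=> k0 l0; rewrite /scale !mulr_gt0// expR_gt0. Qed.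

Lemma ln_scale (k l : R) : 0 < k -> 0 < l -> ln (scale k l) = ln (k * l) + l.
Proof. by move=> k0 l0; rewrite /scale lnM ?posrE ?mulr_gt0 ?expR_gt0// expRK. Qed.

Lemma powR_scale (k l a : R) : 0 < k -> 0 < l ->
  scale k l `^ a = (k * l) `^ a * expR (a * l).
Proof.
move=> k0 l0; rewrite /scale powRM ?expR_ge0 ?mulr_ge0 ?(ltW k0) ?(ltW l0)//.
by rewrite -expRM (mulrC l a).
Qed.

Lemma near_scale_ge (k A : R) : 0 < k -> \forall l \near +oo, A <= scale k l.
Proof.
move=> k0; near=> l.
have l0 : 0 <= l by near: l; exact: near_ge.
have h : A / k <= l by near: l; exact: near_ge.
rewrite /scale; have : A <= k * l by rewrite mulrC -ler_pdivrMr.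
move/le_trans; apply; rewrite ler_peMr ?mulr_ge0 ?(ltW k0)//.
by apply: le_trans (expR_ge1Dx _); rewrite lerDl.
Unshelve. all: by end_near. Qed.

Lemma cvg_scale_pinfty (k : R) : 0 < k -> scale k l @[l --> +oo] --> +oo.
Proof. by move=> k0; apply/cvgryPge => A; exact: near_scale_ge. Qed.

Lemma near_ln_scale_le (k : R) : 0 < k -> \forall l \near +oo, l <= ln (scale k l) <= 2 * l.
Proof.
move=> k0; near=> l.
have l0 : 0 < l.
  suff : 1 <= l by exact: lt_le_trans.
  by near: l; exact: near_ge.
have kl1 : 1 <= k * l.
  by rewrite -ler_pdivrMl// mulr1; near: l; exact: near_ge.
have h1 := ln_ge0 kl1.
have h2 : 2 * (ln k - ln 2^-1) <= l by near: l; exact: near_ge.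
have i20 : 0 < 2^-1 :> R by rewrite invr_gt0.
have h3 := ln_le_linear i20 l0.
have h4 : ln (k * l) = ln k + ln l by rewrite lnM ?posrE.
rewrite ln_scale//; lra.
Unshelve. all: by end_near. Qed.

Section crossover.
Variables (H L : R -> R) (alpha c : R).
Hypothesis alpha2 : 2 < alpha.
Hypothesis L_gt0 : \forall x \near +oo, 0 < L x.
Hypothesis H_upper : forall delta, 0 < delta -> exists C x0, [/\ 0 < C, 0 < x0 &
    forall x, x0 <= x -> H x <= C * x `^ (- (alpha - 1 - delta))].
Hypothesis H_lower : forall delta, 0 < delta -> exists C x0, [/\ 0 < C, 0 < x0 &
    forall x, x0 <= x -> C * x `^ (- (alpha - 1 + delta)) <= H x].
Hypothesis H_comparable : exists a b x0, [/\ 0 < a, 0 < b, 0 < x0 &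
  forall x, x0 <= x ->
    a * (L x * x `^ (1 - alpha)) <= H x <= b * (L x * x `^ (1 - alpha))].

(** H x / eps is o(exp (- eps x0 / mu)) for x of the order of the boundary, where
    exp (- eps x0 / mu) = eps^(c (alpha - 2)) is the value at the boundary x0. *)
Definition tail_negligible := forall k e, 0 < k -> 0 < e ->
  \forall l \near +oo, expR l * H (scale k l) * expR (c * (alpha - 2) * l) <= e.

(** Conversely, exp (- eps x0 / mu) = o(H x / eps) for x of the order of the
    boundary. *)
Definition exponential_negligible := forall k e, 0 < k -> 0 < e ->
  \forall l \near +oo, expR (- l) * expR (- (c * (alpha - 2) * l)) <= e * H (scale k l).

Lemma tail_negligible_subcritical : c < 1 -> tail_negligible.
Proof.
move=> c1 k e k0 e0; have a2 := alpha2.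
pose s := (1 - c) * (alpha - 2).
have s0 : 0 < s by rewrite mulr_gt0// subr_gt0.
pose delta := Num.min (s / 2) ((alpha - 1) / 2).
have d0 : 0 < delta by rewrite lt_min !divr_gt0//; lra.
have ds : delta <= s / 2 by rewrite ge_min lexx.
have da : delta <= (alpha - 1) / 2 by rewrite ge_min lexx orbT.
have [C [x0 [C0 x00 HC]]] := H_upper d0.
near=> l.
have l0 : 0 < l.
  suff : 1 <= l by exact: lt_le_trans.
  by near: l; exact: near_ge.
have kl1 : 1 <= k * l.
  by rewrite -ler_pdivrMl// mulr1; near: l; exact: near_ge.
have x0l : x0 <= scale k l by near: l; exact: near_scale_ge.
have := HC _ x0l; rewrite powR_scale// => h.
have hE : expR (- (s / 2 * l)) <= e / C.
  by near: l; apply: near_expRN_le; rewrite divr_gt0.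
have h1 : (k * l) `^ (- (alpha - 1 - delta)) <= 1.
  rewrite powRN invf_le1 ?powR_gt0 ?mulr_gt0//.
  by rewrite -[leLHS](powRr0 (k * l)) ler_powR//; lra.
apply: (@le_trans _ _ (expR l * (C * (1 * expR (- (alpha - 1 - delta) * l))) * expR (c * (alpha - 2) * l))).
  rewrite ler_pM2r ?expR_gt0// ler_pM2l ?expR_gt0//; apply: (le_trans h).
  by rewrite ler_pM2l// ler_pM2r ?expR_gt0.
have -> : expR l * (C * (1 * expR (- (alpha - 1 - delta) * l))) * expR (c * (alpha - 2) * l)
  = C * expR (l + - (alpha - 1 - delta) * l + c * (alpha - 2) * l).
  by rewrite !expRD; ring.
rewrite mulrC -ler_pdivlMr//; apply: le_trans hE; rewrite ler_expR.
have := ler_wpM2r (ltW l0) ds; rewrite /s; lra.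
Unshelve. all: by end_near. Qed.

(** The powers of eps cancel, leaving L x / l^(alpha - 1) with l between
    (ln x) / 2 and ln x. *)
Lemma tail_negligible_critical : c = 1 ->
  L x / ln x `^ (alpha - 1) @[x --> +oo] --> (0 : R) -> tail_negligible.
Proof.
move=> c1 hL k e k0 e0; have a2 := alpha2.
have [a [b [x0 [_ b0 x00 Hb]]]] := H_comparable.
pose D := b * (k / 2) `^ (1 - alpha).
have D0 : 0 < D by rewrite mulr_gt0// powR_gt0// divr_gt0.
have hL' : \forall x \near +oo, L x / ln x `^ (alpha - 1) <= e / D.
  by apply: (cvgr_le _ hL); rewrite divr_gt0.
near=> l.
have l0 : 0 < l.
  suff : 1 <= l by exact: lt_le_trans.
  by near: l; exact: near_ge.
have x0l : x0 <= scale k l by near: l; exact: near_scale_ge.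
have := Hb _ x0l; move=> /andP[_].
have Lx : 0 < L (scale k l) by near: l; exact: (cvg_scale_pinfty k0 L_gt0).
have hLx : L (scale k l) / ln (scale k l) `^ (alpha - 1) <= e / D.
  by near: l; exact: (cvg_scale_pinfty k0 hL').
have /andP[ll1 ll2] : l <= ln (scale k l) <= 2 * l by near: l; exact: near_ln_scale_le.
have lx0 : 0 < ln (scale k l) by exact: lt_le_trans ll1.
rewrite powR_scale// => h.
apply: (@le_trans _ _ (expR l * (b * (L (scale k l) *
    ((k * l) `^ (1 - alpha) * expR ((1 - alpha) * l)))) * expR (c * (alpha - 2) * l))).
  by rewrite ler_pM2r ?expR_gt0// ler_pM2l ?expR_gt0.
have -> : expR l * (b * (L (scale k l) *
    ((k * l) `^ (1 - alpha) * expR ((1 - alpha) * l)))) * expR (c * (alpha - 2) * l)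
  = b * L (scale k l) * (k * l) `^ (1 - alpha) *
    expR (l + (1 - alpha) * l + c * (alpha - 2) * l).
  by rewrite !expRD; ring.
rewrite (_ : l + (1 - alpha) * l + c * (alpha - 2) * l = 0); last by rewrite c1; ring.
rewrite expR0 mulr1.
have h2 : (k * l) `^ (1 - alpha) <= (k / 2) `^ (1 - alpha) * (ln (scale k l) `^ (alpha - 1))^-1.
  rewrite -powRN opprB -powRM; [|lra|lra].
  rewrite -(opprB alpha 1) !(powRN _ (alpha - 1)) lef_pV2 ?posrE ?powR_gt0 ?mulr_gt0 ?divr_gt0//.
  apply: ge0_ler_powR; rewrite ?nnegrE ?mulr_ge0 ?(ltW k0) ?(ltW l0) ?(ltW lx0)//; first lra.
  have := ler_wpM2l (ltW k0) ll2; lra.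
apply: (le_trans (ler_wpM2l _ h2)); first by rewrite mulr_ge0 ?ltW.
have -> : b * L (scale k l) * ((k / 2) `^ (1 - alpha) * (ln (scale k l) `^ (alpha - 1))^-1)
  = L (scale k l) / ln (scale k l) `^ (alpha - 1) * D by rewrite /D; ring.
by rewrite -ler_pdivlMr.
Unshelve. all: by end_near. Qed.

Lemma exponential_negligible_supercritical : 1 < c -> exponential_negligible.
Proof.
move=> c1 k e k0 e0; have a2 := alpha2.
pose s := (c - 1) * (alpha - 2).
have s0 : 0 < s by rewrite mulr_gt0// subr_gt0.
have d0 : 0 < s / 2 by rewrite divr_gt0.
have [C [x0 [C0 x00 HC]]] := H_lower d0.
near=> l.
have l0 : 0 < l.
  suff : 1 <= l by exact: lt_le_trans.
  by near: l; exact: near_ge.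
have x0l : x0 <= scale k l by near: l; exact: near_scale_ge.
have := HC _ x0l; rewrite powR_scale// => h.
have kl0 : 0 < k * l by rewrite mulr_gt0.
have hE : (k * l) `^ (alpha - 1 + s / 2) * expR (- (s / 2 * l)) <= e * C.
  by near: l; apply: near_power_expRN_le => //; [lra|rewrite mulr_gt0].
apply: le_trans (ler_wpM2l (ltW e0) h).
set q := alpha - 1 + s / 2 in hE *.
have -> : e * (C * ((k * l) `^ (- q) * expR (- q * l))) =
  e * C * expR (- q * l) / (k * l) `^ q by rewrite powRN; ring.
rewrite ler_pdivlMr ?powR_gt0//.
apply: le_trans (ler_wpM2r (expR_ge0 _) hE).
rewrite -[leRHS]mulrA -!expRD [leLHS]mulrC ler_pM2l ?powR_gt0// ler_expR /q /s; lra.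
Unshelve. all: by end_near. Qed.

Lemma exponential_negligible_critical : c = 1 ->
  L x / ln x `^ (alpha - 1) @[x --> +oo] --> +oo -> exponential_negligible.
Proof.
move=> c1 hL k e k0 e0; have a2 := alpha2.
have [a [b [x0 [a0 _ x00 Ha]]]] := H_comparable.
pose D := k `^ (alpha - 1) / (e * a).
have hL' : \forall x \near +oo, D <= L x / ln x `^ (alpha - 1).
  by move/cvgryPge : hL; apply.
near=> l.
have l0 : 0 < l.
  suff : 1 <= l by exact: lt_le_trans.
  by near: l; exact: near_ge.
have x0l : x0 <= scale k l by near: l; exact: near_scale_ge.
have := Ha _ x0l; move=> /andP[h _]; move: h.
have hLx : D <= L (scale k l) / ln (scale k l) `^ (alpha - 1).
  by near: l; exact: (cvg_scale_pinfty k0 hL').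
have /andP[ll1 ll2] : l <= ln (scale k l) <= 2 * l by near: l; exact: near_ln_scale_le.
have lx0 : 0 < ln (scale k l) by exact: lt_le_trans ll1.
rewrite powR_scale// => h.
apply: le_trans (ler_wpM2l (ltW e0) h).
rewrite -expRD (_ : - l + - (c * (alpha - 2) * l) = (1 - alpha) * l); last by rewrite c1; ring.
rewrite !mulrA ler_peMl ?expR_ge0//.
rewrite -(opprB alpha 1) powRN ler_pdivlMr ?powR_gt0 ?mulr_gt0// mul1r.
rewrite powRM ?(ltW k0) ?(ltW l0)//.
move: hLx; rewrite ler_pdivlMr ?powR_gt0// /D => hLx.
have h2 : l `^ (alpha - 1) <= ln (scale k l) `^ (alpha - 1).
  by apply: ge0_ler_powR; rewrite ?nnegrE ?(ltW l0) ?(ltW lx0)//; lra.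
apply: (le_trans (ler_wpM2l (powR_ge0 _ _) h2)).
have ea : 0 < e * a by rewrite mulr_gt0.
have := ler_wpM2l (ltW ea) hLx.
by rewrite mulrA mulrCA mulfV ?gt_eqF// mulr1.
Unshelve. all: by end_near. Qed.

End crossover.
End limits.

(** * Uniform asymptotics of the geometric sums *)

(** The exponent needed in the lower bound when the traffic intensity and the mean
    are both slightly decreased, compared with eps / m. *)
Lemma drift_perturbation (R : realFieldType) (eps v m : R) :
  0 < m -> 0 <= eps <= 4^-1 -> 0 <= v <= 4^-1 ->
  eps / ((1 - eps) * (m * (1 - v))) <= eps / m * (1 + 2 * (eps + v)).
Proof.
move=> m0 /andP[e0 e1] /andP[v0 v1].
have ev : 0 <= eps * v by rewrite mulr_ge0.
have w0 : 0 <= (eps + v) * (1 - 2 * (eps + v)) by rewrite mulr_ge0; lra.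
have h : 1 <= (1 + 2 * (eps + v)) * ((1 - eps) * (1 - v)).
  apply: (@le_trans _ _ ((1 + 2 * (eps + v)) * (1 - (eps + v)))); first lra.
  by apply: ler_wpM2l; lra.
rewrite ler_pdivrMr; last by rewrite !mulr_gt0//; lra.
rewrite (_ : eps / m * (1 + 2 * (eps + v)) * _ =
  eps * ((1 + 2 * (eps + v)) * ((1 - eps) * (1 - v)))); last by field; rewrite gt_eqF.
by rewrite ler_peMr.
Qed.

Section geometric_sums.
Context {d : measure_display} {T : measurableType d} {R : realType}.
Variable P : probability T R.
Variables (X : nat -> {RV P >-> R}) (W : R -> {RV P >-> R}).
Hypothesis (iidX : iid X) (X0 : forall n w, 0 <= X n w).
Hypothesis (PK : forall rho, 0 < rho < 1 -> pollaczek_khintchine rho X (W rho)).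
Local Notation Y := (X 0%N).
Local Notation H := (tail Y).
Variables (mu gamma M : R).
Hypothesis (mu0 : 0 < mu) (gamma01 : 0 < gamma <= 1).
Hypothesis (EY : ('E_P[Y] = mu%:E)%E).
Hypothesis (EYp : (\int[P]_w (Y w `^ (1 + gamma))%:E = M%:E)%E).

Let p12 : 1 <= 1 + gamma <= 2.
Proof. by have /andP[? ?] := gamma01; apply/andP; split; lra. Qed.

Let M0 : 0 <= M. Proof. exact: moment_ge0 EYp. Qed.

(** A sufficient condition, through [mgf_truncated_le], for
    (1 - eps) E[exp (theta min (Y, b))] <= 1, since (1 - eps) (1 + eps) <= 1. *)
Definition chernoff_admissible (eps theta b : R) :=
  theta * mu + theta `^ (1 + gamma) * M * expR (theta * b) <= eps.

Let chernoff_mgf (eps theta b : R) : 0 < eps < 1 -> 0 <= theta -> 0 <= b ->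
  chernoff_admissible eps theta b ->
  ((1 - eps)%:E * \int[P]_w (expR (theta * Num.min (Y w) b))%:E <= 1)%E.
Proof.
move=> /andP[e0 e1] th0 b0 adm.
have r0 : 0 <= 1 - eps by lra.
apply: (@le_trans _ _ ((1 - eps)%:E * (1 + eps)%:E)%E).
  rewrite lee_wpmul2l//.
  apply: (le_trans (mgf_truncated_le (X0 0%N) p12 EY EYp th0 b0)).
  by rewrite lee_fin -addrA lerD2l.
by rewrite -EFinM lee_fin; nra.
Qed.

Let rho01 (eps : R) : 0 < eps < 1 -> 0 < 1 - eps < 1.
Proof. by move=> /andP[? ?]; apply/andP; split; lra. Qed.

(** The price 1 is paid for every jump above b. *)
Lemma tail_le_one_big_jump (eps theta b x : R) :
  0 < eps < 1 -> 0 <= theta -> 0 <= b -> 0 <= x -> chernoff_admissible eps theta b ->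
  tail (W (1 - eps)) x <= expR (- (theta * x)) + eps^-1 * H b.
Proof.
move=> e01 th0 b0 x0 adm; have /andP[e0 e1] := e01.
have := @tail_le_potential _ _ _ P X (W (1 - eps)) (1 - eps) x iidX X0 (rho01 e01) x0
  (PK (rho01 e01)) mu theta b b 0 0 EY th0 (lexx _) (lexx _) (chernoff_mgf e01 th0 b0 adm).
have -> : 1 - (1 - eps) = eps by ring.
rewrite !mul0r !addr0.
move=> h; apply: (le_trans (h _)).
  move=> s t s0 sx t0; rewrite mul0r addr0 mul0r addr0.
  have [tb|bt] := leP t b.
    by rewrite addr0 -expRD -mulrDr ge_min (_ : s - x + t = s + t - x) ?lexx ?orbT//; ring.
  by rewrite ge_min ler_wpDl// mulr_ge0 ?expR_ge0.
rewrite lerD2l ler_wpM2r ?tail_ge0// -[leRHS]mul1r ler_wpM2r ?invr_ge0 ?(ltW e0)//; lra.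
Qed.

(** A jump t in ]eta x, (1 - delta) x] from a position s <= delta x / 2 leaves a
    gap of at least delta x / 2 to be bridged, whence the factor
    exp (- theta delta x / 2); being at s > delta x / 2 is charged by
    Markov's inequality, in the form 1 <= 2 s / (delta x). *)
Lemma tail_le_jump_decomposition (eps theta delta eta x : R) :
  0 < eps < 1 -> 0 <= theta -> 0 < delta -> 0 <= eta -> eta <= 1 - delta -> 0 < x ->
  chernoff_admissible eps theta (eta * x) ->
  tail (W (1 - eps)) x <= expR (- (theta * x)) +
    (1 - eps) / eps * (H ((1 - delta) * x) +
      H (eta * x) * (expR (- (theta * (delta / 2 * x))) + 2 * mu / (delta * (eps * x)))).
Proof.
move=> e01 th0 d0 eta0 etad x0 adm; have /andP[e0 e1] := e01.
have b0 : 0 <= eta * x by rewrite mulr_ge0// ltW.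
have nu0 : 0 <= 2 / (delta * x) by rewrite divr_ge0 ?mulr_ge0 ?ltW.
have l0 := expR_ge0 (- (theta * (delta / 2 * x))).
have := @tail_le_potential _ _ _ P X (W (1 - eps)) (1 - eps) x iidX X0 (rho01 e01) (ltW x0)
  (PK (rho01 e01)) mu theta ((1 - delta) * x) (eta * x) _ _ EY th0 l0 nu0 (chernoff_mgf e01 th0 b0 adm).
have -> : 1 - (1 - eps) = eps by ring.
move=> h; apply: (le_trans (h _)) => {h}.
  move=> s t s0 sx t0.
  have [tb|bt] := leP t (eta * x).
    rewrite mulr0 addr0 ge_min; apply/orP; right.
    rewrite -expRD -mulrDr (_ : s - x + t = s + t - x) ?lerDl//; ring.
  rewrite mulr1; have [tl|tg] := ltP ((1 - delta) * x) t.
    rewrite ge_min; apply/orP; left.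
    have : 0 <= 2 / (delta * x) * s by rewrite mulr_ge0.
    have : 0 <= expR (theta * (s - x)) * expR (theta * (eta * x)) by rewrite mulr_ge0 ?expR_ge0.
    rewrite mulr1n; lra.
  rewrite mulr0n addr0 ler_wpDl ?mulr_ge0 ?expR_ge0//.
  have [sd|sd] := leP s (delta / 2 * x).
    rewrite ge_min; apply/orP; right; apply: ler_wpDr; first by rewrite mulr_ge0.
    by rewrite ler_expR -mulrN ler_wpM2l//; lra.
  rewrite ge_min; apply/orP; left; rewrite ler_wpDl// mulrAC ler_pdivlMr ?mulr_gt0//.
  lra.
have Hb0 : 0 <= H (eta * x) by exact: tail_ge0.
rewrite -addrA lerD2l.
rewrite [leRHS](_ : _ = (1 - eps) / eps * (H ((1 - delta) * x) + expR (- (theta * (delta / 2 * x))) * H (eta * x))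
  + 2 / (delta * x) * H (eta * x) * ((1 - eps) * mu / eps ^+ 2)); last first.
  by field; rewrite !gt_eqF.
rewrite lerD2l; apply: ler_wpM2l; first exact: mulr_ge0.
apply: ler_wpM2r; first by rewrite invr_ge0 sqr_ge0.
apply: ler_wpM2r; first exact: ltW.
nra.
Qed.

Lemma tail_ge_exponential (eps b x : R) : 0 < eps < 1 -> 0 < b -> 0 <= x ->
  0 < mu - b `^ (- gamma) * M ->
  expR (- (eps / ((1 - eps) * (mu - b `^ (- gamma) * M)) * (x + b))) <= tail (W (1 - eps)) x.
Proof.
move=> e01 b0 x0 q0; have /andP[e0 e1] := e01.
have r0 : 0 < 1 - eps by lra.
set theta := eps / _; have th0 : 0 <= theta by rewrite divr_ge0 ?mulr_ge0 ?ltW.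
apply: (@tail_ge_capped_exponential _ _ _ P X (W (1 - eps)) (1 - eps) x iidX X0 (rho01 e01) x0
  (PK (rho01 e01)) theta b th0 (ltW b0)).
have h := mgf_truncated_ge (X0 0%N) p12 EY EYp th0 b0.
rewrite (_ : 1 - (1 + gamma) = - gamma) in h; last ring.
apply: le_trans (lee_wpmul2l _ h); last by rewrite lee_fin ltW.
rewrite -EFinM lee_fin /theta; set q := mu - _ in q0 *.
by have -> : (1 - eps) * (1 + eps / ((1 - eps) * q) * q) = 1 by field; rewrite !gt_eqF.
Qed.

Lemma tail_ge_one_big_jump (eps x : R) : 0 < eps < 1 -> 0 <= x ->
  (1 - eps) * H x / (eps + (1 - eps) * H x) <= tail (W (1 - eps)) x.
Proof.
move=> e01 x0.
have := @tail_ge_big_jump _ _ _ P X (W (1 - eps)) (1 - eps) x iidX X0 (rho01 e01) x0 (PK (rho01 e01)).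
by rewrite (_ : 1 - (1 - eps) = eps)//; ring.
Qed.

Variables (alpha c : R).
Hypothesis (alpha2 : 2 < alpha) (c0 : 0 < c).
Local Notation kappa := ((alpha - 2) * mu).

Let near_eps : \forall l \near (+oo : set_system R), 0 < expR (- l) < 1.
Proof.
near=> l; have : 1 <= l by near: l; exact: near_ge.
by move=> l1; rewrite expR_gt0 expR_lt1; lra.
Unshelve. all: by end_near. Qed.

(** The exponent eps / mu (1 - eps^(gamma / 4)) leaves a margin
    eps^(1 + gamma / 4), which beats the remainder of the moment generating
    function: it is of order eps^(1 + gamma) exp (theta b), and the bound on b
    keeps exp (theta b) below eps^(- gamma / 2). *)
Lemma near_critical_exponent_admissible :
  \forall l \near +oo, forall b, 0 <= b -> b <= scale (mu * gamma / 2) l ->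
    chernoff_admissible (expR (- l)) (expR (- l) / mu * (1 - expR (- (gamma / 4 * l)))) b.
Proof.
have /andP[g0 g1] := gamma01; have m0 := mu0.
pose A := mu * gamma / 2.
have Mm0 : 0 < (M * mu `^ (- (1 + gamma)) + 1)^-1.
  by rewrite invr_gt0 ltr_wpDl// mulr_ge0 ?powR_ge0.
have g40 : 0 < gamma / 4 by rewrite divr_gt0.
near=> l => b b0; rewrite /scale -/A => bA.
have l0 : 0 < l by apply: (@lt_le_trans _ _ 1) => //; near: l; exact: near_ge.
have hM : expR (- (gamma / 4 * l)) <= (M * mu `^ (- (1 + gamma)) + 1)^-1.
  by near: l; exact: near_expRN_le.
set z := expR (- (gamma / 4 * l)) in hM *.
have z0 : 0 < z by exact: expR_gt0.
have z1 : z <= 1 by rewrite expR_le1 oppr_le0 mulr_ge0 ?ltW.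
set eps := expR (- l).
have e0 : 0 < eps by exact: expR_gt0.
set theta := eps / mu * (1 - z).
have th0 : 0 <= theta by rewrite mulr_ge0 ?subr_ge0// divr_ge0 ?(ltW e0) ?(ltW m0).
have thle : theta <= eps / mu.
  by rewrite -[leRHS]mulr1 ler_wpM2l ?divr_ge0 ?(ltW e0) ?(ltW m0)//; lra.
have tp : theta `^ (1 + gamma) <= mu `^ (- (1 + gamma)) * (eps * expR (- (gamma * l))).
  apply: (@le_trans _ _ ((eps / mu) `^ (1 + gamma))).
    by apply: ge0_ler_powR; rewrite ?nnegrE ?divr_ge0 ?(ltW e0) ?(ltW m0)//; lra.
  rewrite powRM ?invr_ge0 ?(ltW e0) ?(ltW m0)// -(powR_inv1 (ltW m0)) -powRrM mulN1r.
  rewrite mulrC ler_wpM2l ?powR_ge0// /eps -expRM -expRD ler_expR; lra.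
have tb : expR (theta * b) <= expR (gamma / 2 * l).
  rewrite ler_expR; apply: (@le_trans _ _ (eps / mu * (A * l * expR l))).
    by apply: ler_pM.
  rewrite (_ : eps / mu * (A * l * expR l) = (eps * expR l) * (A / mu) * l); last ring.
  rewrite /eps -expRD addNr expR0 mul1r ler_pM2r// ler_pdivrMr// /A; lra.
rewrite /chernoff_admissible.
have e1 : theta * mu = eps - eps * z by rewrite /theta; field; rewrite gt_eqF.
rewrite e1.
suff : theta `^ (1 + gamma) * M * expR (theta * b) <= eps * z by lra.
apply: (@le_trans _ _ (mu `^ (- (1 + gamma)) * (eps * expR (- (gamma * l))) * M * expR (gamma / 2 * l))).
  apply: ler_pM; rewrite ?mulr_ge0 ?powR_ge0 ?expR_ge0//.
  by rewrite ler_wpM2r.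
have -> : mu `^ (- (1 + gamma)) * (eps * expR (- (gamma * l))) * M * expR (gamma / 2 * l)
  = eps * z * (M * mu `^ (- (1 + gamma)) * z).
  have : expR (- (gamma * l)) * expR (gamma / 2 * l) = z * z.
    by rewrite /z -!expRD; congr expR; field.
  move=> E; transitivity (eps * (M * mu `^ (- (1 + gamma))) * (z * z)); last by ring.
  by rewrite -E; ring.
rewrite ler_piMr ?mulr_ge0 ?(ltW e0) ?(ltW z0)//.
have N0 : 0 <= M * mu `^ (- (1 + gamma)) by rewrite mulr_ge0 ?powR_ge0.
apply: (le_trans (ler_wpM2l N0 hM)).
by rewrite ler_pdivrMr ?mul1r ?lerDl// ltr_wpDl.
Unshelve. all: by end_near. Qed.

(** Both exponents used differ from eps / mu by a factor 1 + O(eps^sigma) with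
    sigma > 0, and eps x / mu is at most a multiple of log (1 / eps), so that the
    ratio to exp (- eps x / mu) tends to 1; the probability of a large jump is
    negligible by hypothesis. *)
Lemma near_exponential_range : tail_negligible H alpha c -> forall e, 0 < e ->
  \forall l \near +oo, forall x, 0 <= x -> x <= scale (c * kappa) l ->
    `|tail (W (1 - expR (- l))) x / expR (- (expR (- l) * x / mu)) - 1| <= e.
Proof.
move=> neg e e0; have a2 := alpha2; have m0 := mu0; have c0' := c0.
have /andP[g0 g1] := gamma01.
have ca0 : 0 <= c * (alpha - 2) by rewrite mulr_ge0 ?(ltW c0') ?subr_ge0 ?(ltW a2).
have b0 : 0 < mu * gamma / 2 by rewrite divr_gt0 ?mulr_gt0.
have g40 : 0 < gamma / 4 by rewrite divr_gt0.
have g20 : 0 < gamma / 2 by rewrite divr_gt0.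
have e20 : 0 < e / 2 by rewrite divr_gt0.
have e60 : 0 < e / 6 by rewrite divr_gt0.
have lne : 0 < ln (1 + e / 2) by rewrite ln_gt0// ltrDl.
have e6 : e / 6 + e / 6 + e / 6 <= e by lra.
have i4 : 1 + 2 * (4^-1 + 4^-1) <= 2 :> R by lra.
pose tau := M / mu; have tau0 : 0 <= tau by rewrite divr_ge0// ltW.
have k0 : 0 <= 2 * (c * (alpha - 2)) by rewrite mulr_ge0.
near=> l.
have l0 : 0 < l by apply: (@lt_le_trans _ _ 1) => //; near: l; exact: near_ge.
have e01 : 0 < expR (- l) < 1 by near: l; exact: near_eps.
have adm : forall b, 0 <= b -> b <= scale (mu * gamma / 2) l ->
    chernoff_admissible (expR (- l)) (expR (- l) / mu * (1 - expR (- (gamma / 4 * l)))) b.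
  by near: l; exact: near_critical_exponent_admissible.
have negl : expR l * H (scale (mu * gamma / 2) l) * expR (c * (alpha - 2) * l) <= e / 2.
  by near: l; exact: neg.
have zl : c * (alpha - 2) * l * expR (- (gamma / 4 * l)) <= ln (1 + e / 2).
  by near: l; exact: near_linear_expRN_le.
have w1 : expR (- (1 * l)) <= 4^-1 by near: l; apply: near_expRN_le; rewrite ?invr_gt0.
have w2 : expR (- (gamma / 2 * l)) <= 4^-1 / (tau + 1).
  by near: l; apply: near_expRN_le => //; rewrite divr_gt0 ?invr_gt0// ltr_wpDl.
have v1 : 2 * (c * (alpha - 2)) * l * expR (- (1 * l)) <= e / 6.
  by near: l; exact: near_linear_expRN_le.
have v2 : 2 * (c * (alpha - 2)) * tau * l * expR (- (gamma / 2 * l)) <= e / 6.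
  by near: l; apply: near_linear_expRN_le => //; rewrite mulr_ge0.
have v3 : expR (- (2^-1 * l)) <= e / 6 * (mu / 2).
  by near: l; apply: near_expRN_le; rewrite ?invr_gt0// mulr_gt0 ?divr_gt0.
rewrite mul1r in w1 v1.
move=> x x0 xy; set eps := expR (- l) in e01 adm w1 v1 *.
have /andP[eps0 eps1] := e01.
have epsl : eps * expR l = 1 by rewrite /eps -expRD addNr expR0.
have xl : eps * x / mu <= c * (alpha - 2) * l.
  rewrite ler_pdivrMr//; apply: (le_trans (ler_wpM2l (ltW eps0) xy)).
  rewrite /scale (_ : eps * _ = (eps * expR l) * (c * (alpha - 2) * l * mu)); last ring.
  by rewrite epsl mul1r.
have xm0 : 0 <= eps * x / mu by rewrite divr_ge0 ?mulr_ge0 ?(ltW m0) ?(ltW eps0).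
have E0 := expR_gt0 (- (eps * x / mu)).
rewrite ler_distl; apply/andP; split.
- (* The cap eps^(-1/2) is large enough for the lost mean to be o(1 / l), and
     small enough for the overshoot factor exp (- theta b) to tend to 1. *)
  have b'0 := expR_gt0 (2^-1 * l).
  have powb : expR (2^-1 * l) `^ (- gamma) = expR (- (gamma / 2 * l)).
    by rewrite -expRM; congr expR; field.
  set v := expR (- (gamma / 2 * l)) in w2 v2 powb.
  have v0 : 0 < v by exact: expR_gt0.
  have tauv : tau * v <= 4^-1.
    apply: (le_trans (ler_wpM2l tau0 w2)).
    rewrite mulrCA ler_piMr ?invr_ge0// ler_pdivrMr ?mul1r ?lerDl//.
    by rewrite ltr_wpDl.
  have tauM : M = tau * mu by rewrite /tau divfK ?gt_eqF.
  have q0 : 0 < mu - expR (2^-1 * l) `^ (- gamma) * M.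
    rewrite powb tauM (_ : _ - _ = mu * (1 - tau * v)); last ring.
    rewrite mulr_gt0// subr_gt0; apply: le_lt_trans tauv _.
    by rewrite invf_lt1// ltr1n.
  have := tail_ge_exponential e01 b'0 x0 q0.
  rewrite powb tauM (_ : mu - v * (tau * mu) = mu * (1 - tau * v)); last ring.
  have [w wE] : exists w, w = eps + tau * v by eexists.
  have w0 : 0 <= w by rewrite wE; apply: addr_ge0; [exact: ltW|apply: mulr_ge0 => //; exact: ltW].
  have w12 : w <= 4^-1 + 4^-1 by rewrite wE; exact: lerD.
  have thle : eps / ((1 - eps) * (mu * (1 - tau * v))) <= eps / mu * (1 + 2 * w).
    rewrite wE; apply: drift_perturbation => //; first by rewrite w1 ltW.
    by rewrite tauv mulr_ge0// ltW.
  move=> lowb; rewrite ler_pdivlMr//; apply: le_trans lowb.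
  apply: (@le_trans _ _ (expR (- e) * expR (- (eps * x / mu)))).
    by rewrite ler_pM2r//; exact: expR_ge1Dx.
  rewrite -expRD ler_expR -opprD lerN2.
  apply: (le_trans (ler_wpM2r _ thle)); first by rewrite addr_ge0// ltW.
  have k1 : eps / mu * (1 + 2 * w) * (x + expR (2^-1 * l)) =
    eps * x / mu + 2 * w * (eps * x / mu) + (1 + 2 * w) / mu * (eps * expR (2^-1 * l)) by ring.
  have k2 : eps * expR (2^-1 * l) = expR (- (2^-1 * l)).
    by rewrite /eps -expRD; congr expR; field.
  have k3 : 2 * w * (eps * x / mu) <= e / 6 + e / 6.
    apply: (@le_trans _ _ (2 * w * (c * (alpha - 2) * l))); first by rewrite ler_wpM2l// mulr_ge0.
    rewrite (_ : 2 * w * _ = 2 * (c * (alpha - 2)) * l * eps + 2 * (c * (alpha - 2)) * tau * l * v).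
      exact: lerD.
    by rewrite wE; ring.
  have k4 : (1 + 2 * w) / mu * (eps * expR (2^-1 * l)) <= e / 6.
    rewrite k2; apply: (@le_trans _ _ (2 / mu * (e / 6 * (mu / 2)))).
      apply: ler_pM => //; rewrite ?expR_ge0 ?divr_ge0 ?(ltW m0)//.
        by apply: addr_ge0 => //; apply: mulr_ge0.
      rewrite ler_pM2r ?invr_gt0//; apply: le_trans i4.
      by rewrite lerD2l ler_pM2l.
    by rewrite le_eqVlt; apply/orP; left; apply/eqP; field; rewrite gt_eqF.
  rewrite k1 [leRHS]addrC -addrA lerD2l; apply: le_trans e6; exact: lerD.
- have z0 := expR_gt0 (- (gamma / 4 * l)).
  have z1 : expR (- (gamma / 4 * l)) <= 1 by rewrite expR_le1 oppr_le0 mulr_ge0 ?ltW.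
  set z := expR (- (gamma / 4 * l)) in adm zl z0 z1.
  set theta := eps / mu * (1 - z) in adm.
  have th0 : 0 <= theta by rewrite mulr_ge0 ?subr_ge0// divr_ge0 ?(ltW eps0) ?(ltW m0).
  have sc0 : 0 <= scale (mu * gamma / 2) l by apply/ltW/scale_gt0.
  have := tail_le_one_big_jump e01 th0 sc0 x0 (adm _ sc0 (lexx _)).
  move=> upb; rewrite ler_pdivrMr//; apply: (le_trans upb).
  rewrite (_ : 1 + e = (1 + e / 2) + e / 2); last by field.
  rewrite mulrDl; apply: lerD.
    have -> : - (theta * x) = z * (eps * x / mu) + - (eps * x / mu) by rewrite /theta; ring.
    rewrite expRD ler_pM2r// -[leRHS]lnK ?posrE ?addr_gt0// ler_expR.
    apply: le_trans zl; rewrite mulrC; apply: ler_wpM2r => //; exact: ltW.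
  have -> : eps^-1 = expR l by rewrite /eps expRN invrK.
  apply: (@le_trans _ _ (e / 2 * expR (- (c * (alpha - 2) * l)))).
    by rewrite expRN ler_pdivlMr ?expR_gt0.
  by rewrite ler_pM2l// ler_expR lerN2.
Unshelve. all: by end_near. Qed.

Section heavy_tail_range.
Hypothesis H_lower : exists C x0, [/\ 0 < C, 0 < x0 &
    forall x, x0 <= x -> C * x `^ (- alpha) <= H x].
Hypothesis H_scaling : forall lam, 0 < lam -> exists K x0, [/\ 0 < K, 0 < x0 &
    forall x, x0 <= x -> H (lam * x) <= K * H x].
Hypothesis H_continuity : forall e, 0 < e -> exists delta x0, [/\ 0 < delta, delta < 1, 0 < x0 &
    forall x, x0 <= x -> H ((1 - delta) * x) <= (1 + e) * H x].

(** Here theta = (alpha + 1) log x / x with x = exp u, and the jumps are capped at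
    eta x with eta = gamma / (8 (alpha + 1)), so that exp (theta eta x) is only
    x^(gamma / 8) and the remainder is o(theta). *)
Lemma near_log_exponent_admissible : \forall u \near +oo, forall eps,
  (alpha + 1) * u * expR (- u) * mu <= eps / 2 ->
  chernoff_admissible eps ((alpha + 1) * u * expR (- u)) (gamma / (8 * (alpha + 1)) * expR u).
Proof.
have a2 := alpha2; have m0 := mu0; have /andP[g0 g1] := gamma01.
have K0 : 0 < alpha + 1 by lra.
have mM : 0 < mu / (M + 1) by rewrite divr_gt0// ltr_wpDl.
have g20 : 0 < gamma / 2 by rewrite divr_gt0.
near=> u.
have u0 : 0 < u by apply: (@lt_le_trans _ _ 1) => //; near: u; exact: near_ge.
have hp : ((alpha + 1) * u) `^ gamma * expR (- (gamma / 2 * u)) <= mu / (M + 1).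
  by near: u; apply: near_power_expRN_le => //; exact: ltW.
move=> eps hth; set theta := (alpha + 1) * u * expR (- u) in hth *.
have Ku : 0 < (alpha + 1) * u by rewrite mulr_gt0.
have th0 : 0 < theta by rewrite mulr_gt0// expR_gt0.
rewrite /chernoff_admissible.
suff : theta `^ (1 + gamma) * M * expR (theta * (gamma / (8 * (alpha + 1)) * expR u)) <= theta * mu.
  by lra.
have -> : theta * (gamma / (8 * (alpha + 1)) * expR u) = gamma / 8 * u.
  rewrite /theta (_ : _ * _ = (expR (- u) * expR u) * (gamma / 8 * u)); last first.
    by field; rewrite gt_eqF.
  by rewrite -expRD addNr expR0 mul1r.
rewrite powR1D// -2!mulrA ler_pM2l//.
have -> : theta `^ gamma = ((alpha + 1) * u) `^ gamma * expR (- (gamma * u)).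
  by rewrite /theta powRM ?expR_ge0 ?(ltW Ku)// -expRM; congr (_ * expR _); ring.
apply: (@le_trans _ _ (M * (mu / (M + 1)))); last first.
  rewrite mulrCA ler_piMr ?(ltW m0)// ler_pdivrMr ?mul1r ?lerDl//.
  by rewrite ltr_wpDl.
rewrite mulrCA ler_wpM2l//; apply: le_trans hp.
rewrite -[leLHS]mulrA -expRD; apply: ler_wpM2l; first exact: powR_ge0.
rewrite ler_expR.
have : 0 < gamma * u by rewrite mulr_gt0.
by lra.
Unshelve. all: by end_near. Qed.

(** As long as x is at most scale C1 l, the exponent just below eps / mu is used,
    and exp (- theta x) is negligible by hypothesis.  Beyond that,
    theta = (alpha + 1) log x / x is at most eps / (2 mu), by the choice of C1,
    and exp (- theta x) = x^(- alpha - 1) is at most a constant times H x, hence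
    o(H x / eps). *)
Lemma near_admissible_exponent : exponential_negligible H alpha c ->
  forall e A, 0 < e ->
  \forall l \near +oo, forall x, scale (c * kappa) l <= x -> exists theta,
    [/\ 0 <= theta,
        chernoff_admissible (expR (- l)) theta (gamma / (8 * (alpha + 1)) * x),
        expR (- (theta * x)) * expR (- l) <= e * H x &
        A <= theta * x].
Proof.
move=> neg e A e0.
have a2 := alpha2; have m0 := mu0; have /andP[g0 g1] := gamma01; have c0' := c0.
have K0 : 0 < alpha + 1 by lra.
have [C [xC [C0 xC0 HC]]] := H_lower.
have [U1 U10 HU1] := near_pinfty_ex near_log_exponent_admissible.
pose C1 := 4 * (alpha + 1) * mu.
have C10 : 0 < C1 by rewrite !mulr_gt0.
have kap0 : 0 < c * kappa by rewrite !mulr_gt0// subr_gt0.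
have ca0 : 0 < c * (alpha - 2) by rewrite mulr_gt0// subr_gt0.
have e20 : 0 < e / 2 by rewrite divr_gt0.
have g40 : 0 < gamma / 4 by rewrite divr_gt0.
have sg0 : 0 < mu * gamma / 2 by rewrite divr_gt0 ?mulr_gt0.
have ln2 : 0 < ln 2 :> R by rewrite ln_gt0// ltr1n.
have eC0 : 0 < e * C by rewrite mulr_gt0.
near=> l.
have l1 : 1 <= l by near: l; exact: near_ge.
have l0 : 0 < l by exact: lt_le_trans l1.
have e01 : 0 < expR (- l) < 1 by near: l; exact: near_eps.
have adm : forall b, 0 <= b -> b <= scale (mu * gamma / 2) l ->
    chernoff_admissible (expR (- l)) (expR (- l) / mu * (1 - expR (- (gamma / 4 * l)))) b.
  by near: l; exact: near_critical_exponent_admissible.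
have hneg : expR (- l) * expR (- (c * (alpha - 2) * l)) <= e / 2 * H (scale C1 l).
  by near: l; exact: neg.
have zl : c * (alpha - 2) * l * expR (- (gamma / 4 * l)) <= ln 2.
  by near: l; apply: near_linear_expRN_le => //; exact: ltW.
have z2 : expR (- (gamma / 4 * l)) <= 2^-1 by near: l; apply: near_expRN_le; rewrite ?invr_gt0.
have U1l : U1 <= l by near: l; exact: near_ge.
have Al : A <= (alpha + 1) * l.
  by rewrite mulrC -ler_pdivrMr//; near: l; exact: near_ge.
have Al2 : A <= c * (alpha - 2) / 2 * l.
  by rewrite mulrC -ler_pdivrMr ?divr_gt0//; near: l; exact: near_ge.
have hEl : expR (- (1 * l)) <= e * C by near: l; exact: near_expRN_le.
have xCl : xC <= scale C1 l by near: l; exact: near_scale_ge.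
have /andP[ll1 ll2] : l <= ln (scale C1 l) <= 2 * l by near: l; exact: near_ln_scale_le.
rewrite mul1r in hEl.
move=> x yx.
have /andP[eps0 eps1] := e01.
have x0 : 0 < x by apply: lt_le_trans yx; exact: scale_gt0.
have sC0 : 0 < scale C1 l by exact: scale_gt0.
have epsl : expR (- l) * expR l = 1 by rewrite -expRD addNr expR0.
have [xC1|C1x] := leP x (scale C1 l).
- have z0 := expR_gt0 (- (gamma / 4 * l)).
  set z := expR (- (gamma / 4 * l)) in adm zl z2 z0.
  have th0 : 0 <= expR (- l) / mu * (1 - z).
    rewrite mulr_ge0 ?divr_ge0 ?(ltW eps0) ?(ltW m0)// subr_ge0.
    by apply: (le_trans z2); rewrite invf_le1// ler1n.
  have thx : c * (alpha - 2) * l * (1 - z) <= expR (- l) / mu * (1 - z) * x.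
    have z10 : 0 <= 1 - z.
      by rewrite subr_ge0; apply: (le_trans z2); rewrite invf_le1// ler1n.
    rewrite [leRHS]mulrAC; apply: ler_wpM2r => //; rewrite [leRHS]mulrAC ler_pdivlMr//.
    apply: le_trans (ler_wpM2l (ltW eps0) yx).
    rewrite /scale (_ : expR (- l) * _ = (expR (- l) * expR l) * (c * (alpha - 2) * l * mu)); last by ring.
    by rewrite epsl mul1r.
  exists (expR (- l) / mu * (1 - z)); split => //.
  + apply: adm; first by rewrite mulr_ge0 ?(ltW x0)// divr_ge0 ?mulr_ge0 ?(ltW g0) ?(ltW K0).
    apply: (@le_trans _ _ (gamma / (8 * (alpha + 1)) * scale C1 l)).
      by rewrite ler_wpM2l// divr_ge0 ?mulr_ge0 ?(ltW g0) ?(ltW K0).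
    rewrite /scale /C1 le_eqVlt; apply/orP; left; apply/eqP; field.
    by rewrite gt_eqF.
  + apply: (@le_trans _ _ (e * H (scale C1 l))); last first.
      by rewrite ler_pM2l// tail_nonincreasing.
    have -> : e * H (scale C1 l) = 2 * (e / 2 * H (scale C1 l)) by field.
    apply: le_trans (ler_wpM2l _ hneg) => //.
    rewrite mulrC mulrCA ler_pM2l//.
    rewrite (_ : 2 * _ = expR (ln 2 + - (c * (alpha - 2) * l))); last by rewrite expRD lnK ?posrE.
    rewrite ler_expR.
    rewrite lerNl; apply: le_trans thx.
    have -> : c * (alpha - 2) * l * (1 - z) = c * (alpha - 2) * l - c * (alpha - 2) * l * z by ring.
    by rewrite opprD opprK addrC lerD2l lerN2.
  + apply: le_trans thx; apply: (le_trans Al2).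
    rewrite -!mulrA !ler_pM2l// ?subr_gt0// mulrC ler_pM2l//.
    by rewrite lerBrDl -lerBrDr (_ : 1 - 2^-1 = 2^-1)//; field.
- pose u := ln x.
  have xE : x = expR u by rewrite /u lnK.
  have lu : l <= u.
    by apply: (le_trans ll1); rewrite ler_ln ?posrE// ltW.
  have u0 : 0 < u by exact: lt_le_trans lu.
  have thx : (alpha + 1) * u * expR (- u) * x = (alpha + 1) * u.
    by rewrite xE -mulrA -expRD addNr expR0 mulr1.
  have ul : u <= 2 * l * (x / scale C1 l).
    have lam1 : 1 <= x / scale C1 l by rewrite ler_pdivlMr// mul1r ltW.
    have lam0 : 0 < x / scale C1 l by exact: lt_le_trans lam1.
    have -> : u = ln (x / scale C1 l) + ln (scale C1 l).
      by rewrite -lnM ?posrE// divfK ?gt_eqF.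
    have h1 : ln (x / scale C1 l) <= x / scale C1 l - 1.
      rewrite -[X in ln X](subrK 1) addrC; apply: le_ln1Dx.
      by rewrite ltrDr.
    have h2 : x / scale C1 l - 1 <= 2 * l * (x / scale C1 l - 1).
      rewrite ler_peMl ?subr_ge0//; apply: (le_trans l1).
      by rewrite ler_peMl ?ler1n// ltW.
    apply: (le_trans (lerD h1 ll2)); apply: (le_trans (lerD h2 (lexx _))).
    by rewrite mulrBr mulr1 subrK.
  exists ((alpha + 1) * u * expR (- u)); split.
  + by rewrite !mulr_ge0 ?expR_ge0 ?(ltW K0) ?(ltW u0).
  + rewrite xE; apply: HU1; first exact: (le_trans U1l).
    have h : (alpha + 1) * mu * u <= (alpha + 1) * mu * (2 * l * (x / scale C1 l)).
      by rewrite ler_pM2l// mulr_gt0.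
    have xs : (alpha + 1) * mu * (2 * l * (x / scale C1 l)) = x * expR (- l) / 2.
      rewrite /scale /C1 expRN; field.
      by rewrite !gt_eqF ?expR_gt0.
    rewrite (_ : _ * mu = ((alpha + 1) * mu * u) * expR (- u)); last by ring.
    apply: (@le_trans _ _ (x * expR (- l) / 2 * expR (- u))).
      by rewrite ler_pM2r ?expR_gt0// -xs.
    by rewrite xE (_ : _ * _ = expR u * expR (- u) * (expR (- l) / 2)); [rewrite -expRD subrr expR0 mul1r|ring].
  + rewrite thx; have xCx : xC <= x by apply: (le_trans xCl); exact: ltW.
    apply: le_trans (ler_wpM2l (ltW e0) (HC _ xCx)).
    rewrite xE -expRM mulrA.
    apply: (@le_trans _ _ (expR (- l) * expR (u * - alpha))); last first.
      by rewrite ler_pM2r ?expR_gt0.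
    rewrite mulrC ler_pM2l ?expR_gt0// ler_expR.
    by rewrite mulrN lerN2 mulrDl mul1r mulrC lerDl ltW.
  + by rewrite thx; apply: (le_trans Al); rewrite ler_pM2l.
Unshelve. all: by end_near. Qed.

(** The lower bound is the probability of one big jump.  For the upper bound,
    delta is chosen first, by the continuity of H, then eta <= 1 - delta, then
    the constant K comparing H (eta x) with H x; the remaining two terms of
    [tail_le_jump_decomposition] tend to 0 because theta x and eps x tend to
    infinity. *)
Lemma near_heavy_tail_range : exponential_negligible H alpha c -> forall e, 0 < e ->
  \forall l \near +oo, forall x, scale (c * kappa) l <= x ->
    `|tail (W (1 - expR (- l))) x / ((1 - expR (- l)) / expR (- l) * H x) - 1| <= e.
Proof.
move=> neg e e0.
have a2 := alpha2; have m0 := mu0; have /andP[g0 g1] := gamma01; have c0' := c0.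
have K0 : 0 < alpha + 1 by lra.
have kap0 : 0 < c * kappa by rewrite !mulr_gt0// subr_gt0.
have e40 : 0 < e / 4 by rewrite divr_gt0.
have e80 : 0 < e / 8 by rewrite divr_gt0.
have e4 : 1 + e / 4 + (e / 4 + e / 4) + e / 4 = 1 + e by field.
have eM : 0 < e / (M + 1) by rewrite divr_gt0// ltr_wpDl.
have [C [xC [C0 xC0 HC]]] := H_lower.
have [delta [xd [d0 d1 xd0 Hd]]] := H_continuity e40.
pose eta := Num.min (gamma / (8 * (alpha + 1))) (1 - delta).
have eta0 : 0 < eta by rewrite lt_min subr_gt0 d1 andbT divr_gt0// mulr_gt0.
have eta1 : eta <= 1 - delta by rewrite ge_min lexx orbT.
have eta2 : eta <= gamma / (8 * (alpha + 1)) by rewrite ge_min lexx.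
have [K [xK [K_gt0 xK0 HK]]] := H_scaling eta0.
have par : \forall l \near +oo, forall x, scale (c * kappa) l <= x -> exists theta,
    [/\ 0 <= theta,
        chernoff_admissible (expR (- l)) theta (gamma / (8 * (alpha + 1)) * x),
        expR (- (theta * x)) * expR (- l) <= e / 8 * H x &
        2 / delta * (4 * K / e) <= theta * x].
  exact: near_admissible_exponent.
near=> l.
have l0 : 0 < l by apply: (@lt_le_trans _ _ 1) => //; near: l; exact: near_ge.
have e01 : 0 < expR (- l) < 1 by near: l; exact: near_eps.
have parl : forall x, scale (c * kappa) l <= x -> exists theta,
    [/\ 0 <= theta,
        chernoff_admissible (expR (- l)) theta (gamma / (8 * (alpha + 1)) * x),
        expR (- (theta * x)) * expR (- l) <= e / 8 * H x &
        2 / delta * (4 * K / e) <= theta * x] by near: l.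
have epsh : expR (- (1 * l)) <= 2^-1 by near: l; apply: near_expRN_le; rewrite ?invr_gt0.
have sC : xC <= scale (c * kappa) l by near: l; exact: near_scale_ge.
have sd : xd <= scale (c * kappa) l by near: l; exact: near_scale_ge.
have sK : xK <= scale (c * kappa) l by near: l; exact: near_scale_ge.
have kl1 : 1 <= c * kappa * l.
  by rewrite -ler_pdivrMl// mulr1; near: l; exact: near_ge.
have kl2 : 2 * mu / delta * (4 * K / e) <= c * kappa * l.
  by rewrite [leRHS]mulrC -ler_pdivrMr//; near: l; exact: near_ge.
have hM : expR (- (gamma * l)) <= e / (M + 1) by near: l; exact: near_expRN_le.
rewrite mul1r in epsh.
have epsl : expR (- l) * expR l = 1 by rewrite -expRD addNr expR0.
move=> x yx; set eps := expR (- l) in e01 parl epsh epsl *.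
have /andP[eps0 eps1] := e01.
have y0 : 0 < scale (c * kappa) l by exact: scale_gt0.
have x0 : 0 < x by exact: lt_le_trans yx.
have r0 : 0 < 1 - eps by rewrite subr_gt0.
have r2 : 2^-1 <= 1 - eps by rewrite lerBrDl -lerBrDr (_ : 1 - 2^-1 = 2^-1)//; field.
have Hx : 0 < H x.
  apply: lt_le_trans (HC x (le_trans sC yx)).
  by rewrite mulr_gt0// powR_gt0.
have D0 : 0 < (1 - eps) / eps * H x by rewrite !mulr_gt0// invr_gt0.
rewrite ler_distl ler_pdivlMr// ler_pdivrMr//; apply/andP; split.
- have Hsmall : H x <= e * eps.
    apply: (le_trans (tail_nonincreasing _ yx)).
    apply: (le_trans (tail_markov p12 EYp y0)).
    rewrite powR_scale//; apply: (@le_trans _ _ (M * (1 * (eps * expR (- (gamma * l)))))).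
      apply: ler_wpM2l => //; apply: ler_pM; rewrite ?powR_ge0 ?expR_ge0//.
        rewrite powRN invf_le1 ?powR_gt0 ?mulr_gt0//; last by rewrite subr_gt0.
        rewrite -[leLHS](powRr0 (c * kappa * l)) ler_powR//.
        by rewrite addr_ge0// ltW.
      by rewrite -expRD ler_expR mulNr mulrDl mul1r opprD.
    rewrite mul1r mulrCA [leRHS]mulrC ler_pM2l//.
    apply: (le_trans (ler_wpM2l M0 hM)).
    rewrite mulrCA ler_piMr ?(ltW e0)// ler_pdivrMr ?mul1r ?lerDl//.
    by rewrite ltr_wpDl.
  apply: le_trans (tail_ge_one_big_jump e01 (ltW x0)).
  have den0 : 0 < eps + (1 - eps) * H x by rewrite addr_gt0// mulr_gt0.
  rewrite ler_pdivlMr//.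
  have -> : (1 - e) * ((1 - eps) / eps * H x) * (eps + (1 - eps) * H x) =
    (1 - eps) * H x * ((1 - e) * (1 + (1 - eps) * (H x / eps))).
    by field; rewrite gt_eqF.
  rewrite ler_piMr ?mulr_ge0 ?(ltW r0) ?(ltW Hx)//.
  have q1 : H x / eps <= e by rewrite ler_pdivrMr.
  have q0 : 0 <= H x / eps by rewrite divr_ge0 ?(ltW Hx) ?(ltW eps0).
  have q2 : 0 <= (1 - eps) * (H x / eps) <= e.
    rewrite mulr_ge0 ?(ltW r0)//=; apply: le_trans q1; rewrite ler_piMl//.
    by rewrite lerBlDr lerDl ltW.
  move: q2 => /andP[]; move: ((1 - eps) * (H x / eps)) => q q2 q3.
  have -> : (1 - e) * (1 + q) = 1 - ((e - q) + e * q) by ring.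
  by rewrite lerBlDr lerDl addr_ge0 ?subr_ge0// mulr_ge0// ltW.
- have [theta [th0 adm expo thx]] := parl x yx.
  have adm' : chernoff_admissible eps theta (eta * x).
    apply: le_trans adm; rewrite lerD2l ler_wpM2l ?mulr_ge0 ?powR_ge0//.
    by rewrite ler_expR ler_wpM2l// ler_pM2r.
  apply: (le_trans (tail_le_jump_decomposition e01 th0 d0 (ltW eta0) eta1 x0 adm')).
  have t1 : expR (- (theta * x)) <= e / 4 * ((1 - eps) / eps * H x).
    apply: (@le_trans _ _ (e / 8 * H x / eps)); first by rewrite ler_pdivlMr.
    have -> : e / 4 * ((1 - eps) / eps * H x) = (2 * (1 - eps)) * (e / 8 * H x / eps).
      by field; rewrite gt_eqF.
    rewrite ler_peMl//; first by apply: divr_ge0; [apply: mulr_ge0; exact: ltW|exact: ltW].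
    by rewrite -ler_pdivrMl// mulr1.
  have t2 : H ((1 - delta) * x) <= (1 + e / 4) * H x by apply: Hd; exact: le_trans yx.
  have t3 : H (eta * x) <= K * H x by apply: HK; exact: le_trans yx.
  have Ke0 : 0 < 4 * K / e by rewrite divr_gt0// mulr_gt0.
  have t4 : expR (- (theta * (delta / 2 * x))) <= e / 4 / K.
    have -> : e / 4 / K = (4 * K / e)^-1 by field; rewrite !gt_eqF.
    rewrite expRN lef_pV2 ?posrE ?expR_gt0//.
    apply: le_trans (expR_ge1Dx _); rewrite ler_wpDl//.
    have -> : theta * (delta / 2 * x) = delta / 2 * (theta * x) by ring.
    rewrite -ler_pdivrMl ?divr_gt0// (_ : (delta / 2)^-1 = 2 / delta)//.
    by field; rewrite gt_eqF.
  have t5 : 2 * mu / (delta * (eps * x)) <= e / 4 / K.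
    have -> : e / 4 / K = (4 * K / e)^-1 by field; rewrite !gt_eqF.
    have ex0 : 0 < eps * x by rewrite mulr_gt0.
    have -> : 2 * mu / (delta * (eps * x)) = (eps * x / (2 * mu / delta))^-1.
      by field; rewrite !gt_eqF.
    rewrite lef_pV2 ?posrE ?divr_gt0 ?mulr_gt0//.
    rewrite ler_pdivlMr ?divr_gt0 ?mulr_gt0// mulrC; apply: (le_trans kl2).
    apply: le_trans (ler_wpM2l (ltW eps0) yx).
    rewrite /scale (_ : eps * _ = (eps * expR l) * (c * kappa * l)); last by ring.
    by rewrite epsl mul1r.
  have t6 : H (eta * x) * (expR (- (theta * (delta / 2 * x))) + 2 * mu / (delta * (eps * x)))
      <= (e / 4 + e / 4) * H x.
    apply: (@le_trans _ _ (K * H x * (e / 4 / K + e / 4 / K))).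
      apply: ler_pM; rewrite ?tail_ge0//; last exact: lerD.
      by rewrite addr_ge0 ?expR_ge0// divr_ge0 ?mulr_ge0 ?(ltW m0) ?(ltW d0) ?(ltW eps0) ?(ltW x0).
    by rewrite le_eqVlt; apply/orP; left; apply/eqP; field; rewrite gt_eqF.
  have r1 : 0 <= (1 - eps) / eps by rewrite divr_ge0 ?(ltW r0) ?(ltW eps0).
  apply: (le_trans (lerD t1 (ler_wpM2l r1 (lerD t2 t6)))).
  rewrite -e4 le_eqVlt; apply/orP; left; apply/eqP; ring.
Unshelve. all: by end_near. Qed.

End heavy_tail_range.
End geometric_sums.

(** * The limit as the traffic intensity increases to 1 *)
Section uniform_limits.
Context {R : realType}.

Lemma cvg_log_left1 : ln ((1 - rho)^-1) @[rho --> (1:R)^'-] --> +oo.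
Proof.
apply/cvgryPge => A; near=> rho.
have r1 : rho < 1 by near: rho; exact: nbhs_left_lt.
have rA : 1 - expR (- A) < rho by near: rho; apply: nbhs_left_gt; rewrite gtrBl expR_gt0.
rewrite -[leLHS]expRK ler_ln ?posrE ?expR_gt0 ?invr_gt0 ?subr_gt0//.
by rewrite -[leLHS]invrK lef_pV2 ?posrE ?invr_gt0 ?expR_gt0 ?subr_gt0// -expRN; lra.
Unshelve. all: by end_near. Qed.

Lemma ereal_sup_cvg0 (F : set_system R) (FF : Filter F) (D : R -> set R) (f : R -> R -> R) :
  (forall rho x, 0 <= f rho x) ->
  (forall e, 0 < e -> \forall rho \near F,
     (exists x, D rho x) /\ forall x, D rho x -> f rho x <= e) ->
  ereal_sup [set (f rho x)%:E | x in D rho] @[rho --> F] --> 0%E.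
Proof.
move=> f0 H.
have key e : 0 < e -> \forall rho \near F,
    (0%:E <= ereal_sup [set (f rho x)%:E | x in D rho] <= e%:E)%E.
  move=> e0; apply: filterS (H _ e0) => rho [[x Dx] fx] /=.
  apply/andP; split.
    apply: (@le_trans _ _ (f rho x)%:E); first by rewrite lee_fin.
    by apply: ereal_sup_ubound; exists x.
  by apply: ge_ereal_sup => _ [z Dz <-]; rewrite lee_fin; exact: fx.
apply/fine_cvgP; split.
  apply: filterS (key _ ltr01) => rho /andP[s0 s1].
  by rewrite ge0_fin_numE// (le_lt_trans s1)// ltry.
apply/cvgrPdist_le => e e0; apply: filterS (key _ e0) => rho /andP[/=].
case: (ereal_sup _) => [r| |]//; rewrite !lee_fin => r0 re.
by rewrite sub0r normrN ger0_norm.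
Qed.

End uniform_limits.

Section positive_part.
Context {d : measure_display} {T : measurableType d} {R : realType}.
Variable P : probability T R.

Lemma measurable_positive_part (Y : {RV P >-> R}) :
  measurable_fun setT (fun w => Num.max (Y w) 0).
Proof. exact: measurable_maxr. Qed.

(** The density makes X n positive only almost surely, whereas the comparison
    principle is stated for walks with nonnegative steps; replacing X n by its
    positive part changes the partial sums on a null set only. *)
Definition positive_part (Y : {RV P >-> R}) : {RV P >-> R} :=
  HB.pack (fun w => Num.max (Y w) 0) (isMeasurableFun.Build _ _ _ _ _ (measurable_positive_part Y)).

Lemma positive_partE Y w : positive_part Y w = Num.max (Y w) 0.
Proof. by []. Qed.

Let measurable_max0 (B : set R) : measurable B -> measurable [set t : R | B (Num.max t 0)].
Proof.
move=> mB; have m : measurable_fun setT (fun t : R => Num.max t 0) by exact: measurable_maxr.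
by rewrite -[X in measurable X]setTI; exact: m.
Qed.

Lemma positive_part_iid (X : nat -> {RV P >-> R}) :
  iid X -> iid (fun n => positive_part (X n)).
Proof.
move=> [ind same]; split.
  move=> s B us mB.
  by apply: (ind s (fun i => [set t | B i (Num.max t 0)]) us) => i; exact: measurable_max0.
by move=> n A mA; apply: (same n [set t | A (Num.max t 0)]); exact: measurable_max0.
Qed.

Lemma positive_part_ccdf (Y : {RV P >-> R}) (r : R) : 0 <= r ->
  ccdf (positive_part Y) r = ccdf Y r.
Proof.
move=> r0; rewrite /ccdf /distribution /pushforward; congr (P _).
apply/seteqP; split => w /=; rewrite !in_itv/= !andbT lt_max.
  by case/orP => //; rewrite ltNge r0.
by move=> ->.
Qed.

Lemma positive_part_pollaczek_khintchine (X : nat -> {RV P >-> R}) (W : {RV P >-> R}) rho :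
  (forall n, distribution P (X n) `]-oo, 0%R[ = 0%E) ->
  pollaczek_khintchine rho X W -> pollaczek_khintchine rho (fun n => positive_part (X n)) W.
Proof.
move=> X0 PK x x0; rewrite (PK x x0).
congr (limn _); apply/funext => N; apply: eq_bigr => n _; congr (_ * _)%E.
pose N0 := \bigcup_i (X i @^-1` `]-oo, 0%R[).
have mN0 : measurable N0 by apply: bigcup_measurable => i _; exact: measurable_funPTI.
have PN0 : P N0 = 0%E.
  apply/eqP; rewrite eq_le measure_ge0 andbT.
  pose A i := X i @^-1` `]-oo, 0%R[.
  have mA i : measurable (A i) by exact: measurable_funPTI.
  apply: (le_trans (measure_sigma_subadditive P mA mN0 (@subset_refl _ N0))).
  by rewrite eseries0// => i _ _; exact: X0.
have E w : ~ N0 w -> partial_sum (fun n => positive_part (X n)) n w = partial_sum X n w.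
  move=> Nw; apply: eq_bigr => i _; rewrite positive_partE; apply/max_idPl.
  by rewrite leNgt; apply/negP => Xi; apply: Nw; exists i => //=; rewrite in_itv.
have mgt (Z : nat -> {RV P >-> R}) : measurable [set w | x < partial_sum Z n w].
  exact: measurable_partial_sum_gt.
rewrite -(measureU0 (mgt X) mN0 PN0) -[RHS](measureU0 (mgt _) mN0 PN0).
congr (P _); apply/seteqP; split => w /= [h|]; try by right.
  by have [?|Nw] := pselect (N0 w); [right|left; rewrite E].
by have [?|Nw] := pselect (N0 w); [right|left; rewrite -E].
Qed.

End positive_part.

Theorem corollary2p3 (R : realType) (d : measure_display)
  (T : measurableType d) (P : probability T R)
  (V : nat -> {RV P >-> R}) (U : R -> nat -> {RV P >-> R})
  (W : R -> {RV P >-> R}) (X : nat -> {RV P >-> R})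
  (L : R -> R) (alpha c : R) (y : R -> R)
  (hinput : forall rho, 0 < rho < 1 ->
     MG1_input (rho / mean (V 0%N)) V (U rho))
  (hW : forall rho, 0 < rho < 1 ->
     steady_state_waiting_time V (U rho) (W rho))
  (hXiid : iid X)
  (hXdensity : has_density_pos (X 0%N)
     (fun t => tail (V 0%N) t / mean (V 0%N)))
  (hPK : forall rho, 0 < rho < 1 -> pollaczek_khintchine rho X (W rho))
  (halpha : 2 < alpha)
  (hL : slowly_varying L)
  (hV : asymp_equiv (tail (V 0%N)) (fun x => L x * x `^ (- alpha)))
  (hc : 0 < c)
  (hy : forall rho, 0 < rho < 1 ->
     let kappa := (alpha - 2) * second_moment (V 0%N) / (2 * mean (V 0%N)) in
     y rho = c * kappa * (1 - rho)^-1 * ln ((1 - rho)^-1)) :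
  ((c < 1 -> heavy_traffic_approx (V 0%N) W y) /\
   (c = 1 -> L x / ln x `^ (alpha - 1) @[x --> +oo] --> (0 : R) ->
      heavy_traffic_approx (V 0%N) W y)) /\
  ((1 < c -> heavy_tail_approx (X 0%N) W y) /\
   (c = 1 -> L x / ln x `^ (alpha - 1) @[x --> +oo] --> +oo ->
      heavy_tail_approx (X 0%N) W y)).
Proof.
set V0 := V 0%N; set m := mean V0 in hXdensity hy.
have V_ge0 w : 0 <= V0 w.
  have h1 : 0 < 2^-1 :> R by rewrite invr_gt0.
  have h2 : 2^-1 < 1 :> R by rewrite invf_lt1 ?ltr1n.
  have h : 0 < (2^-1 : R) < 1 by rewrite h1 h2.
  by have [h3 _ _ _] := hinput _ h; exact: h3.
have Gni s t : s <= t -> tail V0 t <= tail V0 s by exact: tail_nonincreasing.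
have G0 t : 0 <= tail V0 t by exact: tail_ge0.
have Gp t : 0 < tail V0 t by exact: (regvar_gt0 Gni hL hV).
have dV0 : 0 < (alpha - 2) / 2 by lra.
have [CV [xV [CV0 xV0 HCV]]] := regvar_power_upper Gni G0 hL hV dV0.
have a1 : 1 < alpha - (alpha - 2) / 2 by lra.
have a2 : 2 < alpha - (alpha - 2) / 2 by lra.
have fin1 := moment_finite xV0 (ltW CV0) ltr01 a1 V_ge0 HCV.
have fin2 := moment_finite xV0 (ltW CV0) (ltr0n R 2) a2 V_ge0 HCV.
have mE : (\int[P]_w (V0 w `^ 1)%:E = m%:E)%E.
  have -> : m = fine (\int[P]_w (V0 w `^ 1)%:E)%E.
    rewrite /m /mean unlock; congr fine; apply: eq_integral => w _.
    by rewrite powRr1.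
  rewrite fineK// ge0_fin_numE//; apply: integral_ge0 => w _.
  by rewrite lee_fin powR_ge0.
pose sm := second_moment V0.
have smE : (\int[P]_w (V0 w ^+ 2)%:E = sm%:E)%E.
  rewrite /sm /second_moment unlock fineK// ge0_fin_numE//.
    rewrite (_ : (\int[P]_w _)%E = (\int[P]_w (V0 w `^ 2)%:E)%E)//.
    by apply: eq_integral => w _; rewrite powR_mulrn.
  by apply: integral_ge0 => w _; rewrite lee_fin sqr_ge0.
have m0 : 0 < m.
  have p1 : 1 <= (1 : R) <= 2 by rewrite lexx ler1n.
  have := tail_markov p1 mE ltr01; rewrite powR1 mulr1.
  exact: lt_le_trans.
have sm0 : 0 < sm.
  have p2 : 1 <= (2 : R) <= 2 by rewrite lexx ler1n.
  have smE' : (\int[P]_w (V0 w `^ 2)%:E = sm%:E)%E.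
    by rewrite -smE; apply: eq_integral => w _; rewrite powR_mulrn.
  have := tail_markov p2 smE' ltr01; rewrite powR1 mulr1.
  exact: lt_le_trans.
pose Y n := positive_part (X n).
have Y0 n w : 0 <= Y n w by rewrite /Y positive_partE le_max lexx orbT.
have iidY : iid Y by exact: positive_part_iid.
have PKY rho : 0 < rho < 1 -> pollaczek_khintchine rho Y (W rho).
  move=> r01; apply: positive_part_pollaczek_khintchine (hPK _ r01) => n.
  case: hXiid => _ /(_ n) ->//; rewrite hXdensity//.
  rewrite (_ : _ `&` _ = set0) ?integral_set0//.
  apply/seteqP; split => z //=; rewrite !in_itv/= andbT => -[z0].
  by rewrite ltNge ltW.
have YX r : 0 <= r -> ccdf (Y 0%N) r = ccdf (X 0%N) r by exact: positive_part_ccdf.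
have HYX r : 0 <= r -> tail (Y 0%N) r = tail (X 0%N) r.
  by move=> r0; rewrite /tail YX.
pose mu := sm / (2 * m).
have mu0 : 0 < mu by rewrite divr_gt0// mulr_gt0.
have EY : ('E_P[Y 0%N] = mu%:E)%E.
  rewrite (equilibrium_mean V_ge0 m0 hXdensity (Y0 0%N) YX) smE -EFinM.
  by congr EFin; rewrite /mu; field; rewrite gt_eqF.
pose H := tail (Y 0%N).
have H0 t : 0 <= H t by exact: tail_ge0.
have Hni s t : s <= t -> H t <= H s by exact: tail_nonincreasing.
have Hcvg : H t @[t --> +oo] --> (0 : R).
  by apply: fine_cvg; exact: cvg_ccdfy0.
have Hle s t : 0 <= s -> s <= t -> H s - H t <= (t - s) * (tail V0 s / m).
  move=> s0 st; rewrite /H !HYX ?(le_trans s0)//.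
  exact: (equilibrium_tail_increment_le m0 hXdensity).
have Hge s t : 0 <= s -> s <= t -> (t - s) * (tail V0 t / m) <= H s - H t.
  move=> s0 st; rewrite /H !HYX ?(le_trans s0)//.
  exact: (equilibrium_tail_increment_ge m0 hXdensity).
pose gamma := Num.min 1 ((alpha - 2) / 2).
have g01 : 0 < gamma <= 1 by rewrite lt_min ltr01 dV0 ge_min lexx.
have ga : gamma <= (alpha - 2) / 2 by rewrite ge_min lexx orbT.
have dX0 : 0 < (alpha - 2) / 4 by lra.
have [CX [xX [CX0 xX0 HCX]]] :=
  integrated_tail_power_upper Gni G0 hL hV m0 halpha Hcvg Hle dX0.
have q0 : 0 < 1 + gamma by case/andP: g01 => ? _; lra.
have qa : 1 + gamma < alpha - 1 - (alpha - 2) / 4 by lra.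
have finX := moment_finite xX0 (ltW CX0) q0 qa (Y0 0%N) HCX.
pose M := fine (\int[P]_w (Y 0%N w `^ (1 + gamma))%:E)%E.
have ME : (\int[P]_w (Y 0%N w `^ (1 + gamma))%:E = M%:E)%E.
  rewrite /M fineK// ge0_fin_numE//; apply: integral_ge0 => w _.
  by rewrite lee_fin powR_ge0.
have yE rho : 0 < rho < 1 -> y rho = scale (c * ((alpha - 2) * mu)) (ln ((1 - rho)^-1)).
  move=> r01; rewrite hy//= /scale lnK; last first.
    by rewrite posrE invr_gt0 subr_gt0; case/andP: r01.
  by rewrite /mu /sm /m; ring.
have kap0 : 0 < c * ((alpha - 2) * mu) by apply: mulr_gt0 => //; apply: mulr_gt0 => //; rewrite subr_gt0.
have rhoE rho : rho < 1 -> expR (- ln ((1 - rho)^-1)) = 1 - rho.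
  by move=> r1; rewrite expRN lnK ?invrK// posrE invr_gt0 subr_gt0.
have light : tail_negligible H alpha c -> heavy_traffic_approx V0 W y.
  move=> neg; apply: ereal_sup_cvg0; first by move=> *; exact: normr_ge0.
  move=> e e0.
  have main := cvg_log_left1 (near_exponential_range iidY Y0 PKY mu0 g01 EY ME halpha hc neg e0).
  near=> rho.
  have r0 : 0 < rho by near: rho; exact: nbhs_left_gt.
  have r1 : rho < 1 by near: rho; exact: nbhs_left_lt.
  have r01 : 0 < rho < 1 by rewrite r0.
  have l0 : 0 < ln ((1 - rho)^-1).
    by rewrite ln_gt0// invf_gt1 ?subr_gt0//; lra.
  split.
    by exists 0 => /=; rewrite lexx yE// ltW// scale_gt0.
  move=> x /= /andP[x0]; rewrite yE// => xy.
  have : forall x, 0 <= x -> x <= scale (c * ((alpha - 2) * mu)) (ln ((1 - rho)^-1)) ->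
    `|tail (W (1 - expR (- ln ((1 - rho)^-1)))) x /
       expR (- (expR (- ln ((1 - rho)^-1)) * x / mu)) - 1| <= e by near: rho.
  move=> /(_ x x0 xy); rewrite rhoE// subKr.
  rewrite (_ : 2 * (1 - rho) * mean V0 * x / second_moment V0 = (1 - rho) * x / mu)//.
  rewrite /mu -/m -/sm; field.
  by rewrite !gt_eqF.
have heavy : exponential_negligible H alpha c -> heavy_tail_approx (X 0%N) W y.
  move=> neg; apply: ereal_sup_cvg0; first by move=> *; exact: normr_ge0.
  move=> e e0.
  have Hlow : exists C x0, [/\ 0 < C, 0 < x0 & forall x, x0 <= x -> C * x `^ (- alpha) <= H x].
    have := integrated_tail_power_lower Gni G0 hL hV m0 H0 Hge ltr01.
    by rewrite (_ : alpha - 1 + 1 = alpha)//; ring.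
  have Hscal lam : 0 < lam -> exists K x0, [/\ 0 < K, 0 < x0 &
      forall x, x0 <= x -> H (lam * x) <= K * H x].
    exact: (integrated_tail_scaling Gni G0 hL hV m0 H0 Hni Hle Hge).
  have Hcont e' : 0 < e' -> exists delta x0, [/\ 0 < delta, delta < 1, 0 < x0 &
      forall x, x0 <= x -> H ((1 - delta) * x) <= (1 + e') * H x].
    exact: (integrated_tail_continuity Gni G0 hL hV m0 H0 Hle Hge).
  have main := cvg_log_left1 (near_heavy_tail_range iidY Y0 PKY mu0 g01 EY ME halpha hc
    Hlow Hscal Hcont neg e0).
  near=> rho.
  have r0 : 0 < rho by near: rho; exact: nbhs_left_gt.
  have r1 : rho < 1 by near: rho; exact: nbhs_left_lt.
  have r01 : 0 < rho < 1 by rewrite r0.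
  have l0 : 0 < ln ((1 - rho)^-1).
    by rewrite ln_gt0// invf_gt1 ?subr_gt0//; lra.
  split; first by exists (y rho) => /=.
  move=> x /=; rewrite yE// => yx.
  have x0 : 0 <= x by apply: le_trans yx; apply/ltW/scale_gt0.
  have : forall x, scale (c * ((alpha - 2) * mu)) (ln ((1 - rho)^-1)) <= x ->
    `|tail (W (1 - expR (- ln ((1 - rho)^-1)))) x /
       ((1 - expR (- ln ((1 - rho)^-1))) / expR (- ln ((1 - rho)^-1)) * H x) - 1| <= e by near: rho.
  by move=> /(_ x yx); rewrite rhoE// subKr /H HYX.
have up :=
  integrated_tail_power_upper Gni G0 hL hV m0 halpha Hcvg Hle.
have low :=
  integrated_tail_power_lower Gni G0 hL hV m0 H0 Hge.
have comp := integrated_tail_comparable Gni G0 hL hV m0 halpha H0 Hcvg Hle Hge.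
have Lp := slowly_varying_gt0 hL.
split; split => [c1|c1 hLc].
- by apply: light; exact: tail_negligible_subcritical.
- by apply: light; exact: (@tail_negligible_critical _ H L).
- by apply: heavy; exact: exponential_negligible_supercritical.
- by apply: heavy; exact: (@exponential_negligible_critical _ H L).
Unshelve. all: by end_near. Qed.
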